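(* Let $H$ be a weak Hopf algebra with bijective antipode, let $A/B$ be a restricted flat weak $H$-Galois extension, and let $M$ be an $A^e$-module. Then for any $q\geq0$ there exists a right action of $H$ on $H^q(B,M)$.
   Context: Everything is over a fixed field $k$; unadorned tensor products are over $k$; $\Delta(h)=h_1\otimes h_2$ (summation omitted). A weak Hopf algebra $H$ is a $k$-space with an associative unital algebra structure $(H,m,1)$ and a coassociative counital coalgebra structure $(H,\Delta,\varepsilon)$ such that: $\Delta$ is multiplicative (not necessarily unit preserving) and $(\Delta\otimes id)\Delta(1)=(\Delta(1)\otimes1)(1\otimes\Delta(1))=(1\otimes\Delta(1))(\Delta(1)\otimes1)$; $\varepsilon(xyz)=\varepsilon(xy_1)\varepsilon(y_2z)=\varepsilon(xy_2)\varepsilon(y_1z)$; and there is an algebra and coalgebra anti-homomorphism $S:H\to H$ (the antipode) with $x_1S(x_2)=\varepsilon(1_1x)1_2$, $S(x_1)x_2=1_1\varepsilon(x1_2)$, $S(x_1)x_2S(x_3)=S(x)$. Here $\Delta(1)=1_1\otimes 1_2$. Put $\varepsilon_t(x)=\varepsilon(1_1x)1_2$, $\varepsilon_s(x)=1_1\varepsilon(x1_2)$, and $H_s=\varepsilon_s(H)$. A right $H$-comodule algebra is an algebra $A$ with a right $H$-comodule structure $\rho:A\to A\otimes H$, $a\mapsto a_{(0)}\otimes a_{(1)}$, such that $\rho(ab)=\rho(a)\rho(b)$ and $1_{(0)}a\otimes 1_{(1)}=a_{(0)}\otimes\varepsilon_t(a_{(1)})$, where $\rho(1)=1_{(0)}\otimes1_{(1)}$.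 Its coinvariants are the subalgebra $A^{coH}=\{a\in A\mid \rho(a)=a_{(0)}\otimes\varepsilon_t(a_{(1)})\}$. Put $A\overline{\otimes}H=\{\sum_i a_i1_{(0)}\otimes h_i1_{(1)}\mid \sum_i a_i\otimes h_i\in A\otimes H\}\subseteq A\otimes H$. With $B=A^{coH}$, $A/B$ is a weak $H$-Galois extension if $\mathrm{can}:A\otimes_BA\to A\overline{\otimes}H$, $a\otimes_Ba'\mapsto aa'_{(0)}\otimes a'_{(1)}$, is bijective. The translation map is $\kappa:H\to A\otimes_BA$, $\kappa(h)=\mathrm{can}^{-1}(1_{(0)}\otimes h1_{(1)})$. The extension is flat if $A$ is flat both as a left and as a right $B$-module, and restricted if $\kappa(H_s)\subseteq B\otimes_BB$ (inside $A\otimes_BA$). $A^e=A\otimes A^{op}$ is the enveloping algebra of $A$, so $A^e$-modules are $A$-$A$-bimodules. $H^q(B,M)$ denotes the $q$-th Hochschild cohomology group of $B$ with coefficients in $M$, where $M$ is regarded as a $B$-$B$-bimodule by restriction of scalars; that is, $H^q(B,-)$ is the $q$-th right derived functor of $\mathrm{Hom}_{B^e}(B,-)$ on $B^e$-modules. *)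

(* Defs.v *)
From HB Require Import structures.
From mathcomp Require Import all_boot all_algebra.
From mathcomp Require Import boolp classical_sets functions.

Set Implicit Arguments.
Unset Strict Implicit.
Unset Printing Implicit Defensive.

Import GRing.Theory.
Local Open Scope ring_scope.
Local Open Scope quotient_scope.

Lemma zmod_morphismD (V W : zmodType) (f : V -> W) :
  zmod_morphism f -> {morph f : x y / x + y}.
Proof.
move=> fB; pose hf := GRing.isZmodMorphism.Build _ _ _ fB.
pose f' : {additive _ -> _} := HB.pack f hf.
exact: (raddfD f').
Qed.

(* Balanced tensor product of X and Y: the quotient of the formal sums
   x_1 ⊗ y_1 + ... + x_n ⊗ y_n (encoded as lists of pairs) which identifies
   two sums exactly when every biadditive map f with f (r i x) y = f x (l i y)
   takes the same value on both.  This is the usual quotient of the free abelian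
   group on X * Y; see tliftE, tlift_is_additive and tens_ind for the universal
   property. *)
Section BalancedTensor.
Context (I : Type) (X Y : zmodType) (r : I -> X -> X) (l : I -> Y -> Y).

Definition balanced (W : zmodType) (f : X -> Y -> W) : Prop :=
  [/\ forall x x' y, f (x + x') y = f x y + f x' y,
      forall x y y', f x (y + y') = f x y + f x y' &
      forall i x y, f (r i x) y = f x (l i y)].

Definition fsum (W : zmodType) (f : X -> Y -> W) (s : seq (X * Y)) : W :=
  \sum_(p <- s) f p.1 p.2.

Definition tens_rel (s s' : seq (X * Y)) : bool :=
  `[< forall (W : zmodType) (f : X -> Y -> W),
        balanced f -> fsum f s = fsum f s' >].

Lemma tens_rel_equiv : equiv_class_of tens_rel.
Proof.
split=> [s|s s'|s s' s''].
- exact/asboolP.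
- by apply/asboolP/asboolP => h W f bf; rewrite h.
- by move=> /asboolP h /asboolP h'; apply/asboolP => W f bf; rewrite h // h'.
Qed.
Canonical tens_rel_equivRel := EquivRelPack tens_rel_equiv.

Definition btens : Type := {eq_quot tens_rel}.
HB.instance Definition _ := Choice.on btens.
HB.instance Definition _ := EqQuotient.on btens.

Definition tens (x : X) (y : Y) : btens := \pi_btens [:: (x, y)].

(* The map sending the tensor of x and y to f x y.  It is defined for every f
   by picking a representative, but this is only meaningful if f is balanced. *)
Definition tlift (W : zmodType) (f : X -> Y -> W) (t : btens) : W :=
  fsum f (repr t).

Lemma tlift_pi (W : zmodType) (f : X -> Y -> W) s :
  balanced f -> tlift f (\pi_btens s) = fsum f s.
Proof.
rewrite /tlift => bf; have /eqmodP/asboolP : \pi_btens (repr (\pi_btens s)) = \pi s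
  by rewrite reprK.
exact.
Qed.

Lemma tens_pi s s' :
  (forall (W : zmodType) (f : X -> Y -> W), balanced f -> fsum f s = fsum f s') ->
  \pi_btens s = \pi_btens s'.
Proof. by move=> h; apply/eqmodP/asboolP. Qed.

Lemma tens_eqP (t u : btens) :
  (forall (W : zmodType) (f : X -> Y -> W), balanced f -> tlift f t = tlift f u) ->
  t = u.
Proof. by rewrite -[t]reprK -[u]reprK => h; apply: tens_pi => W f bf; rewrite -!tlift_pi // h. Qed.

Lemma balancedN (W : zmodType) (f : X -> Y -> W) x y :
  balanced f -> f (- x) y = - f x y.
Proof.
case=> fD _ _; have f0 : f 0 y = 0 by apply: (addrI (f 0 y)); rewrite -fD !addr0.
by apply/eqP; rewrite -addr_eq0 -fD addNr f0.
Qed.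

Definition tens0 : btens := \pi_btens [::].
Definition tensN (t : btens) : btens :=
  \pi_btens [seq (- p.1, p.2) | p <- repr t].
Definition tensD (t u : btens) : btens := \pi_btens (repr t ++ repr u).

Lemma tlift_tens0 (W : zmodType) (f : X -> Y -> W) :
  balanced f -> tlift f tens0 = 0.
Proof. by move=> bf; rewrite tlift_pi // /fsum big_nil. Qed.

Lemma tlift_tensN (W : zmodType) (f : X -> Y -> W) t :
  balanced f -> tlift f (tensN t) = - tlift f t.
Proof.
move=> bf; rewrite tlift_pi // /tlift /fsum big_map -sumrN.
by apply: eq_bigr => p _ /=; rewrite balancedN.
Qed.

Lemma tlift_tensD (W : zmodType) (f : X -> Y -> W) t u :
  balanced f -> tlift f (tensD t u) = tlift f t + tlift f u.
Proof. by move=> bf; rewrite tlift_pi // /fsum big_cat. Qed.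

Lemma tensDA : associative tensD.
Proof. by move=> t u v; apply: tens_eqP => W f bf; rewrite !tlift_tensD ?addrA. Qed.
Lemma tensDC : commutative tensD.
Proof. by move=> t u; apply: tens_eqP => W f bf; rewrite !tlift_tensD 1?addrC. Qed.
Lemma tens0D : left_id tens0 tensD.
Proof.
by move=> t; apply: tens_eqP => W f bf; rewrite tlift_tensD ?tlift_tens0 ?add0r.
Qed.
Lemma tensND : left_inverse tens0 tensN tensD.
Proof.
move=> t; apply: tens_eqP => W f bf.
by rewrite tlift_tensD ?tlift_tensN ?tlift_tens0 ?addNr.
Qed.

HB.instance Definition _ := GRing.isZmodule.Build btens tensDA tensDC tens0D tensND.

Lemma tliftE (W : zmodType) (f : X -> Y -> W) x y :
  balanced f -> tlift f (tens x y) = f x y.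
Proof. by move=> bf; rewrite tlift_pi // /fsum big_seq1. Qed.

Lemma tlift_is_additive (W : zmodType) (f : X -> Y -> W) :
  balanced f -> zmod_morphism (tlift f).
Proof. by move=> bf t u; rewrite [tlift f _]tlift_tensD // tlift_tensN. Qed.

Lemma tens_balanced : balanced tens.
Proof.
split=> *; apply: tens_eqP => W f bf; rewrite ?[tlift f (_ + _)]tlift_tensD //;
  by rewrite !tliftE //; case: bf.
Qed.

Lemma tens_ind (P : btens -> Prop) :
  P 0 -> (forall x y t, P t -> P (tens x y + t)) -> forall t, P t.
Proof.
move=> P0 PD t; rewrite -[t]reprK; elim: (repr t) => [|[x y] s IHs] //.
suff -> : \pi_btens ((x, y) :: s) = tens x y + \pi_btens s by exact: PD.
apply: tens_eqP => W f bf; rewrite [RHS]tlift_tensD // tliftE // !tlift_pi //.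
by rewrite /fsum big_cons.
Qed.
End BalancedTensor.

Definition ktens (k : fieldType) (X Y : lmodType k) : Type :=
  btens (fun (c : k) (x : X) => c *: x) (fun (c : k) (y : Y) => c *: y).
Notation "X ⊗ Y" := (ktens X%type Y%type) (at level 40, left associativity).

Definition ktensor (k : fieldType) (X Y : lmodType k) (x : X) (y : Y) : X ⊗ Y :=
  tens _ _ x y.
Notation "x ⊠ y" := (ktensor x y) (at level 40, left associativity) : ring_scope.

Section TensorField.
Context (k : fieldType) (X Y : lmodType k).

HB.instance Definition _ := GRing.Zmodule.on (X ⊗ Y).

Lemma ktensor_balanced :
  balanced (fun (c : k) (x : X) => c *: x) (fun (c : k) (y : Y) => c *: y)
    (@ktensor k X Y).
Proof. exact: tens_balanced. Qed.

Lemma ktensorDl (x x' : X) (y : Y) : (x + x') ⊠ y = x ⊠ y + x' ⊠ y.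
Proof. by case: ktensor_balanced. Qed.
Lemma ktensorDr (x : X) (y y' : Y) : x ⊠ (y + y') = x ⊠ y + x ⊠ y'.
Proof. by case: ktensor_balanced. Qed.
Lemma ktensorZC c (x : X) (y : Y) : (c *: x) ⊠ y = x ⊠ (c *: y).
Proof. by case: ktensor_balanced. Qed.

Lemma ktens_ext (W : zmodType) (F G : X ⊗ Y -> W) :
  zmod_morphism F -> zmod_morphism G ->
  (forall x y, F (x ⊠ y) = G (x ⊠ y)) -> F =1 G.
Proof.
move=> FB GB h; pose hF := GRing.isZmodMorphism.Build _ _ F FB.
pose hG := GRing.isZmodMorphism.Build _ _ G GB.
pose F' : {additive _ -> _} := HB.pack F hF; pose G' : {additive _ -> _} := HB.pack G hG.
have F0 : F 0 = 0 := raddf0 F'; have G0 : G 0 = 0 := raddf0 G'.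
have FD : {morph F : t u / t + u} := raddfD F'.
have GD : {morph G : t u / t + u} := raddfD G'.
by elim/tens_ind=> [|x y t IHt]; rewrite ?F0 ?G0 // FD GD h IHt.
Qed.

Definition ktens_scale (c : k) : X ⊗ Y -> X ⊗ Y := tlift (fun x y => (c *: x) ⊠ y).

Lemma ktens_scale_balanced c :
  balanced (fun (c : k) (x : X) => c *: x) (fun (c : k) (y : Y) => c *: y)
    (fun x y => (c *: x) ⊠ y).
Proof.
split=> [x x' y|x y y'|d x y]; rewrite ?scalerDr ?ktensorDl ?ktensorDr //.
by rewrite scalerA mulrC -scalerA ktensorZC.
Qed.

Let scB c : zmod_morphism (ktens_scale c).
Proof. exact: tlift_is_additive (ktens_scale_balanced c). Qed.
Let scE c (x : X) (y : Y) : ktens_scale c (x ⊠ y) = (c *: x) ⊠ y.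
Proof. exact: tliftE (ktens_scale_balanced c). Qed.

Lemma ktens_scaleA a b t : ktens_scale a (ktens_scale b t) = ktens_scale (a * b) t.
Proof.
move: t; apply: ktens_ext => [t u|t u|x y]; rewrite ?scB ?scE //.
by rewrite scalerA.
Qed.

Lemma ktens_scale1 : left_id 1 ktens_scale.
Proof. by apply: ktens_ext => [t u|t u|x y]; rewrite ?scB ?scE ?scale1r. Qed.

Lemma ktens_scaleDr : right_distributive ktens_scale +%R.
Proof.
move=> c; pose hS := GRing.isZmodMorphism.Build _ _ _ (scB c).
pose S : {additive _ -> _} := HB.pack (ktens_scale c) hS.
exact: (raddfD S).
Qed.

Lemma ktens_scaleDl t : {morph ktens_scale^~ t : a b / a + b}.
Proof.
move=> a b; move: t; apply: ktens_ext => [t u|t u|x y]; rewrite ?scB ?scE //.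
  by rewrite opprD addrACA.
by rewrite scalerDl ktensorDl.
Qed.

HB.instance Definition _ := GRing.Zmodule_isLmodule.Build k (X ⊗ Y)
  ktens_scaleA ktens_scale1 ktens_scaleDr ktens_scaleDl.

Lemma ktensorZl c (x : X) (y : Y) : (c *: x) ⊠ y = c *: (x ⊠ y).
Proof. by rewrite -scE. Qed.
Lemma ktensorZr c (x : X) (y : Y) : x ⊠ (c *: y) = c *: (x ⊠ y).
Proof. by rewrite -ktensorZC ktensorZl. Qed.
End TensorField.

(* x ⊠ y is sent to f x ⊠ g y. *)
Definition ktmap (k : fieldType) (X X' Y Y' : lmodType k)
    (f : X -> X') (g : Y -> Y') : X ⊗ Y -> X' ⊗ Y' :=
  tlift (fun x y => f x ⊠ g y).

Definition ktassoc (k : fieldType) (X Y Z : lmodType k) : X ⊗ Y ⊗ Z -> X ⊗ (Y ⊗ Z) :=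
  tlift (fun t z => tlift (fun x y => x ⊠ (y ⊠ z)) t).

Definition ktswap (k : fieldType) (X Y : lmodType k) : X ⊗ Y -> Y ⊗ X :=
  tlift (fun x y => y ⊠ x).

(* Used to show that 1 ⊠ 1 != 0 in the tensor product of two algebras. *)
Section LinearFunctional.
Local Open Scope classical_set_scope.

Lemma linear_functional_neq0 (k : fieldType) (V : lmodType k) (v : V) :
  v != 0 -> exists2 phi : V -> k^o, linear phi & phi v != 0.
Proof.
move=> v0.
pose P (W : set V) := (forall a x y, W x -> W y -> W (a *: x + y)) /\ ~ W v.
have [F FP Ftot|W [[Wlin Wv] Wmax]] := @Zorn_bigcup V P.
  split=> [a x y [X FX Xx] [Y FY Yy]|[X FX Xv]]; last by case: (FP _ FX) => _; exact.
  have [XY|YX] := Ftot _ _ FX FY.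
    by exists Y => //; apply: (FP _ FY).1 => //; apply: XY.
  by exists X => //; apply: (FP _ FX).1 => //; apply: YX.
have W0 : W 0.
  apply: contrapT => W0; apply: (Wmax [set 0]).
    split=> [x Wx|sub]; last by apply: W0; apply: sub.
    by exfalso; apply: W0; rewrite -(addNr x) -scaleN1r; apply: Wlin.
  split=> [a x y -> ->|/= v_0]; first by rewrite /= scaler0 addr0.
  by rewrite v_0 eqxx in v0.
have WZ a x : W x -> W (a *: x) by move=> Wx; rewrite -[_ *: _]addr0; apply: Wlin.
have dec x : exists c : k, W (x - c *: v).
  apply: contrapT => /forallNP nW.
  pose W' := [set z | exists a, W (z - a *: x)].
  apply: (Wmax W').
    split=> [z Wz|W'W]; first by exists 0; rewrite scale0r subr0.
    apply: (nW 0); rewrite scale0r subr0; apply: W'W.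
    by exists 1; rewrite scale1r subrr.
  split=> [a y z [b Wy] [c Wz]|[a Wa]].
    exists (a * b + c); rewrite scalerDl -scalerA opprD addrACA -scalerBr.
    exact: Wlin.
  have [a0|a0] := eqVneq a 0; first by rewrite a0 scale0r subr0 in Wa.
  apply: (nW a^-1); have := WZ (- a^-1) _ Wa.
  by rewrite scalerBr scalerA mulNr mulVf // !scaleNr scale1r opprK addrC.
have uniq c : W (c *: v) -> c = 0.
  move=> Wc; apply: contrapT => /eqP c0; apply: Wv.
  by rewrite -[v]scale1r -(mulVf c0) -scalerA; apply: WZ.
pose phi x : k := projT1 (cid (dec x)).
have phiP x : W (x - phi x *: v) by rewrite /phi; case: cid.
exists phi => [a x y|].
  apply/eqP; rewrite -subr_eq0; apply/eqP/uniq.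
  have := Wlin (-1) _ _ (phiP (a *: x + y)) (Wlin a _ _ (phiP x) (phiP y)).
  congr W; rewrite scaleN1r opprB scalerBr scalerBl scalerDl -scalerA.
  by rewrite [_ - _ + (y - _)]addrACA [LHS]addrA subrK opprD.
apply: contra_notN Wv => /eqP phi0; have := phiP v.
by rewrite phi0 scale0r subr0.
Qed.
End LinearFunctional.

Section TensorAlgebra.
Context (k : fieldType) (A C : algType k).

Definition ktmul1 (a : A) (c : C) : A ⊗ C -> A ⊗ C :=
  tlift (fun a' c' => (a * a') ⊠ (c * c')).
Definition ktmul (t u : A ⊗ C) : A ⊗ C := tlift (fun a c => ktmul1 a c u) t.

Let mul1_bal a c : balanced (fun (s : k) (x : A) => s *: x) (fun (s : k) (y : C) => s *: y)
    (fun a' c' => (a * a') ⊠ (c * c') : A ⊗ C).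
Proof.
split=> *; rewrite ?mulrDr ?ktensorDl ?ktensorDr //.
by rewrite -!scalerAr ktensorZC.
Qed.

Let mul1B a c : zmod_morphism (ktmul1 a c).
Proof. exact: tlift_is_additive (mul1_bal a c). Qed.
Let mul1E a c a' c' : ktmul1 a c (a' ⊠ c') = (a * a') ⊠ (c * c').
Proof. exact: tliftE (mul1_bal a c). Qed.

Let mul1_balr u : balanced (fun (s : k) (x : A) => s *: x) (fun (s : k) (y : C) => s *: y)
    (fun a c => ktmul1 a c u).
Proof.
split=> [a a' c|a c c'|s a c]; move: u; apply: ktens_ext => [t u|t u|x y];
  rewrite ?mul1B ?mul1E ?opprD 1?addrACA //.
- by rewrite mulrDl ktensorDl.
- by rewrite mulrDl ktensorDr.
- by rewrite -!scalerAl ktensorZC.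
Qed.

Lemma ktmulE (a a' : A) (c c' : C) :
  ktmul (a ⊠ c) (a' ⊠ c') = (a * a') ⊠ (c * c').
Proof. by rewrite /ktmul (tliftE _ _ (mul1_balr _)). Qed.

Lemma ktmulBl u : zmod_morphism (ktmul^~ u).
Proof. exact: tlift_is_additive (mul1_balr u). Qed.

Lemma ktmulBr t : zmod_morphism (ktmul t).
Proof.
move=> u v; move: t; apply: ktens_ext => [s t|s t|a c].
- exact: ktmulBl.
- by rewrite !ktmulBl opprD addrACA -opprD.
- by rewrite /ktmul !(tliftE _ _ (mul1_balr _)) mul1B.
Qed.

Lemma ktmulA : associative ktmul.
Proof.
move=> t u v; move: t; apply: ktens_ext => [s t|s t|a c].
- exact: ktmulBl.
- by rewrite !ktmulBl.
move: u; apply: ktens_ext => [s t|s t|a' c'].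
- by rewrite ktmulBl ktmulBr.
- by rewrite ktmulBr ktmulBl.
move: v; apply: ktens_ext => [s t|s t|a'' c'']; rewrite ?ktmulBr //.
by rewrite !ktmulE !mulrA.
Qed.

Lemma ktmul1l : left_id (1 ⊠ 1) ktmul.
Proof.
apply: ktens_ext => [t u|t u|a c]; rewrite ?ktmulBr //.
by rewrite ktmulE !mul1r.
Qed.
Lemma ktmul1r : right_id (1 ⊠ 1) ktmul.
Proof.
apply: ktens_ext => [t u|t u|a c]; rewrite ?ktmulBl //.
by rewrite ktmulE !mulr1.
Qed.


Lemma ktmulDl : left_distributive ktmul +%R.
Proof. by move=> t u v; apply: (zmod_morphismD (ktmulBl v)). Qed.
Lemma ktmulDr : right_distributive ktmul +%R.
Proof. by move=> t u v; apply: (zmod_morphismD (ktmulBr t)). Qed.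

Lemma ktens1_neq0 : 1 ⊠ 1 != 0 :> A ⊗ C.
Proof.
have [phi phi_lin phi1] := linear_functional_neq0 (oner_neq0 A).
have [psi psi_lin psi1] := linear_functional_neq0 (oner_neq0 C).
pose hphi := GRing.isLinear.Build k A k^o _ phi phi_lin.
pose hpsi := GRing.isLinear.Build k C k^o _ psi psi_lin.
pose phi' : {linear A -> k^o} := HB.pack phi hphi.
pose psi' : {linear C -> k^o} := HB.pack psi hpsi.
have bal : balanced (fun (s : k) (x : A) => s *: x) (fun (s : k) (y : C) => s *: y)
    (fun a c => phi' a * psi' c : k).
  split=> *; rewrite ?linearD ?mulrDl ?mulrDr // !linearZ /=.
  by rewrite /GRing.scale /= mulrCA mulrA.
apply/eqP=> t0; have := tliftE 1 1 bal.
rewrite -[tens _ _ _ _]/(1 ⊠ 1) t0 [tlift _ 0]tlift_tens0 // => /esym/eqP.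
by rewrite mulf_eq0 (negPf phi1) (negPf psi1).
Qed.

HB.instance Definition _ := GRing.Zmodule_isNzRing.Build (A ⊗ C)
  ktmulA ktmul1l ktmul1r ktmulDl ktmulDr ktens1_neq0.

Lemma ktensorM (a a' : A) (c c' : C) : (a ⊠ c) * (a' ⊠ c') = (a * a') ⊠ (c * c').
Proof. exact: ktmulE. Qed.

Lemma ktens_scalerAl (s : k) (t u : A ⊗ C) : s *: (t * u) = (s *: t) * u.
Proof.
move: t; apply: ktens_ext => [t v|t v|a c].
- by rewrite mulrBl scalerBr.
- by rewrite scalerBr mulrBl.
move: u; apply: ktens_ext => [t v|t v|a' c'].
- by rewrite mulrBr scalerBr.
- by rewrite mulrBr.
by rewrite -ktensorZl !ktensorM -ktensorZl scalerAl.
Qed.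
Lemma ktens_scalerAr (s : k) (t u : A ⊗ C) : s *: (t * u) = t * (s *: u).
Proof.
move: t; apply: ktens_ext => [t v|t v|a c].
- by rewrite mulrBl scalerBr.
- by rewrite mulrBl.
move: u; apply: ktens_ext => [t v|t v|a' c'].
- by rewrite mulrBr scalerBr.
- by rewrite scalerBr mulrBr.
by rewrite -ktensorZl !ktensorM -ktensorZl scalerAr.
Qed.
HB.instance Definition _ := GRing.Lmodule_isLalgebra.Build k (A ⊗ C)
  ktens_scalerAl.
HB.instance Definition _ := GRing.Lalgebra_isAlgebra.Build k (A ⊗ C)
  ktens_scalerAr.
End TensorAlgebra.

Section ConverseAlgebra.
Context (k : fieldType) (A : algType k).

Lemma conv_scaleA a b (v : A^c) :
  (a *: (b *: (v : A)) : A^c) = (a * b) *: (v : A).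
Proof. exact: scalerA. Qed.
Lemma conv_scale1 : left_id 1 (fun (a : k) (v : A^c) => a *: (v : A) : A^c).
Proof. exact: scale1r. Qed.
Lemma conv_scaleDr :
  right_distributive (fun (a : k) (v : A^c) => a *: (v : A) : A^c) +%R.
Proof. exact: scalerDr. Qed.
Lemma conv_scaleDl (v : A^c) :
  {morph (fun a : k => a *: (v : A) : A^c) : a b / a + b}.
Proof. by move=> a b; apply: scalerDl. Qed.

HB.instance Definition _ := GRing.Zmodule_isLmodule.Build k A^c
  conv_scaleA conv_scale1 conv_scaleDr conv_scaleDl.

Lemma conv_scaleAl (c : k) (u v : A^c) : c *: (u * v) = (c *: u) * v.
Proof. exact: (@scalerAr k A). Qed.
Lemma conv_scaleAr (c : k) (u v : A^c) : c *: (u * v) = u * (c *: v).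
Proof. exact: (@scalerAl k A). Qed.
HB.instance Definition _ := GRing.Lmodule_isLalgebra.Build k A^c conv_scaleAl.
HB.instance Definition _ := GRing.Lalgebra_isAlgebra.Build k A^c conv_scaleAr.
End ConverseAlgebra.

HB.mixin Record isWeakHopf (k : fieldType) H of GRing.Algebra k H := {
  comul : {linear H -> H ⊗ H};
  counit : {linear H -> k^o};
  antipode : {linear H -> H};
  comulA : forall h, ktassoc (ktmap comul id (comul h)) = ktmap id comul (comul h);
  counitl : forall h, tlift (fun h1 h2 => counit h1 *: h2) (comul h) = h;
  counitr : forall h, tlift (fun h1 h2 => counit h2 *: h1) (comul h) = h;
  comulM : forall x y, comul (x * y) = comul x * comul y;
  comul1l : ktassoc (ktmap comul id (comul 1)) =
    ktassoc (comul 1 ⊠ 1) * (1 ⊠ comul 1);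
  comul1r : ktassoc (ktmap comul id (comul 1)) =
    (1 ⊠ comul 1) * ktassoc (comul 1 ⊠ 1);
  counitMl : forall x y z, counit (x * y * z) =
    tlift (fun y1 y2 => counit (x * y1) * counit (y2 * z)) (comul y);
  counitMr : forall x y z, counit (x * y * z) =
    tlift (fun y1 y2 => counit (x * y2) * counit (y1 * z)) (comul y);
  antipode1 : antipode 1 = 1;
  antipodeM : forall x y, antipode (x * y) = antipode y * antipode x;
  counit_antipode : forall x, counit (antipode x) = counit x;
  comul_antipode : forall x,
    comul (antipode x) = ktmap antipode antipode (ktswap (comul x));
  mul_id_antipode : forall x,
    tlift (fun x1 x2 => x1 * antipode x2) (comul x) =
    tlift (fun u1 u2 => counit (u1 * x) *: u2) (comul 1);
  mul_antipode_id : forall x,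
    tlift (fun x1 x2 => antipode x1 * x2) (comul x) =
    tlift (fun u1 u2 => counit (x * u2) *: u1) (comul 1);
  mul_antipode_id_antipode : forall x,
    tlift (fun t x3 => tlift (fun x1 x2 => antipode x1 * x2 * antipode x3) t)
      (ktmap comul id (comul x)) = antipode x
}.
#[short(type="weakHopfType")]
HB.structure Definition WeakHopf (k : fieldType) :=
  {H of isWeakHopf k H & GRing.Algebra k H}.

Section WeakHopfTheory.
Context (k : fieldType) (H : weakHopfType k).

(* eps_t x = eps(1_1 x) 1_2 and eps_s x = 1_1 eps(x 1_2) *)
Definition eps_t (x : H) : H :=
  tlift (fun u1 u2 => counit (u1 * x) *: u2) (comul (1 : H)).
Definition eps_s (x : H) : H :=
  tlift (fun u1 u2 => counit (x * u2) *: u1) (comul (1 : H)).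

Definition H_s : set H := range eps_s.
End WeakHopfTheory.

HB.mixin Record isComodAlg (k : fieldType) (H : weakHopfType k) A of GRing.Algebra k A := {
  coact : {linear A -> A ⊗ H};
  coactA : forall a, ktassoc (ktmap coact id (coact a)) = ktmap id comul (coact a);
  coact_counit : forall a, tlift (fun a0 a1 => counit a1 *: a0) (coact a) = a;
  coactM : forall a b, coact (a * b) = coact a * coact b;
  coact1 : forall a, coact 1 * (a ⊠ 1) = ktmap id (@eps_t k H) (coact a)
}.
#[short(type="comodAlgType")]
HB.structure Definition ComodAlg (k : fieldType) (H : weakHopfType k) :=
  {A of isComodAlg k H A & GRing.Algebra k A}.

Section Coinvariants.
Context (k : fieldType) (H : weakHopfType k) (A : comodAlgType H).

Definition coinvariant : {pred A} :=
  fun a => `[< coact a = ktmap id (@eps_t k H) (coact a) >].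

Lemma coinvariantP (a : A) : reflect (coact a = coact 1 * (a ⊠ 1)) (a \in coinvariant).
Proof. by apply: (iffP (asboolP _)); rewrite coact1. Qed.

Lemma coinvariant_subalg : GRing.subalg_closed coinvariant.
Proof.
split=> [|c a b /coinvariantP ha /coinvariantP hb|a b /coinvariantP ha /coinvariantP hb];
  apply/coinvariantP.
- by rewrite -[1 ⊠ 1]/(1 : A ⊗ H) mulr1.
- by rewrite linearP ha hb ktensorDl ktensorZl mulrDr scalerAr.
- rewrite coactM hb mulrA -coactM mulr1 ha -mulrA; congr (_ * _).
  by rewrite ktensorM mulr1.
Qed.
HB.instance Definition _ := GRing.isSubalgClosed.Build k A coinvariant coinvariant_subalg.

Record coinv : Type := Coinv { coinv_val : A; _ : coinv_val \in coinvariant }.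
HB.instance Definition _ := [isSub for coinv_val].
HB.instance Definition _ := [Choice of coinv by <:].
HB.instance Definition _ := [SubChoice_isSubAlgebra of coinv by <:].

Definition coinv_incl : coinv -> A := val.
HB.instance Definition _ := GRing.isZmodMorphism.Build _ _ coinv_incl
  (rmorphB (val : {rmorphism coinv -> A})).
HB.instance Definition _ := GRing.isMonoidMorphism.Build _ _ coinv_incl
  (rmorph1 (val : {rmorphism coinv -> A}), rmorphM (val : {rmorphism coinv -> A})).
HB.instance Definition _ := GRing.isScalable.Build k coinv A _ coinv_incl
  (linearZZ (val : {linear coinv -> A})).
End Coinvariants.

(* Restriction of scalars of the S-module M along f : R -> S. *)
Definition restr (R S : pzRingType) (f : {rmorphism R -> S}) (M : lmodType S) : Type := M.

Section Restriction.
Context (R S : pzRingType) (f : {rmorphism R -> S}) (M : lmodType S).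
HB.instance Definition _ := GRing.Zmodule.on (restr f M).

Definition restr_scale (a : R) (m : restr f M) : restr f M := f a *: (m : M).
Lemma restr_scaleA a b m : restr_scale a (restr_scale b m) = restr_scale (a * b) m.
Proof. by rewrite /restr_scale scalerA rmorphM. Qed.
Lemma restr_scale1 : left_id 1 restr_scale.
Proof. by move=> m; rewrite /restr_scale rmorph1 scale1r. Qed.
Lemma restr_scaleDr : right_distributive restr_scale +%R.
Proof. by move=> a m n; rewrite /restr_scale -scalerDr. Qed.
Lemma restr_scaleDl m : {morph restr_scale^~ m : a b / a + b}.
Proof. by move=> a b; rewrite /restr_scale rmorphD scalerDl. Qed.
HB.instance Definition _ := GRing.Zmodule_isLmodule.Build R (restr f M)
  restr_scaleA restr_scale1 restr_scaleDr restr_scaleDl.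
End Restriction.

Section ConverseMorphism.
Context (R S : pzRingType) (f : {rmorphism R -> S}).
Definition conv_map (x : R^c) : S^c := f x.
Lemma conv_map_is_additive : zmod_morphism conv_map.
Proof. exact: (rmorphB f). Qed.
Lemma conv_map_is_multiplicative : monoid_morphism conv_map.
Proof. by split=> [|x y]; [exact: (rmorph1 f) | exact: (rmorphM f)]. Qed.
HB.instance Definition _ := GRing.isZmodMorphism.Build _ _ conv_map conv_map_is_additive.
HB.instance Definition _ := GRing.isMonoidMorphism.Build _ _ conv_map conv_map_is_multiplicative.
End ConverseMorphism.

(* X ⊗_R Y for a right R-module X, that is a module over R^c, and a left
   R-module Y. *)
Definition mtens (R : pzRingType) (X : lmodType R^c) (Y : lmodType R) : zmodType :=
  btens (fun (b : R) (x : X) => (b : R^c) *: x) (fun (b : R) (y : Y) => b *: y).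

Definition mtensor (R : pzRingType) (X : lmodType R^c) (Y : lmodType R)
  (x : X) (y : Y) : mtens X Y := tens _ _ x y.

Definition flat_left (R : pzRingType) (Y : lmodType R) : Prop :=
  forall (X X' : lmodType R^c) (f : {linear X -> X'}), injective f ->
    injective (tlift (fun x y => mtensor (f x) y) : mtens X Y -> mtens X' Y).

Definition flat_right (R : pzRingType) (X : lmodType R^c) : Prop :=
  forall (Y Y' : lmodType R) (f : {linear Y -> Y'}), injective f ->
    injective (tlift (fun x y => mtensor x (f y)) : mtens X Y -> mtens X Y').

Section GaloisExtension.
Local Open Scope classical_set_scope.
Context (k : fieldType) (H : weakHopfType k) (A : comodAlgType H).
Local Notation B := (coinv A).

(* A as a left and as a right B-module. *)
Definition A_left : lmodType B := restr (@coinv_incl k H A : {rmorphism B -> A}) A^o.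
Definition A_right : lmodType B^c := 
  restr (conv_map (@coinv_incl k H A) : {rmorphism B^c -> A^c}) (A^c)^o.

Definition can : mtens A_right A_left -> A ⊗ H :=
  tlift (fun a a' : A => (a ⊠ 1) * coact a').

(* The elements sum_i a_i 1_(0) ⊗ h_i 1_(1) of A ⊗ H. *)
Definition wtens : set (A ⊗ H) := range (fun t : A ⊗ H => t * coact 1).

Definition weak_galois : Prop := set_bij setT wtens can.

Definition kappa (h : H) : mtens A_right A_left :=
  'pinv_(fun=> 0) setT can ((1 ⊠ h) * coact 1).

(* The image of B ⊗_B B in A ⊗_B A. *)
Definition BtensB : set (mtens A_right A_left) :=
  range (tlift (fun b b' : B => mtensor (coinv_incl b : A_right) (coinv_incl b' : A_left))
           : mtens (B^c)^o B^o -> mtens A_right A_left).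

Definition restricted : Prop := kappa @` @H_s k H `<=` BtensB.

Definition flat_extension : Prop := flat_left A_left /\ flat_right A_right.
End GaloisExtension.

Section Enveloping.
Context (k : fieldType).

Definition env (A : algType k) : algType k := A ⊗ A^c.

Definition env_map (A A' : algType k) (f : {lrmorphism A -> A'}) : env A -> env A' :=
  ktmap (f : A -> A') (f : A^c -> A'^c).

Section EnvMap.
Context (A A' : algType k) (f : {lrmorphism A -> A'}).

Lemma env_map_balanced :
  balanced (fun (c : k) (x : A) => c *: x) (fun (c : k) (x : A^c) => c *: x)
    (fun (x : A) (y : A^c) => ((f x : A') ⊠ (f y : A'^c)) : A' ⊗ A'^c).
Proof.
split=> [x x' y|x y y'|c x y].
- by rewrite -ktensorDl rmorphD.
- by rewrite -ktensorDr -[f (y + y')]/(f ((y : A) + (y' : A))) rmorphD.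
- by rewrite linearZ ktensorZC -[f (c *: y)]/(f (c *: (y : A))) linearZ.
Qed.

Lemma env_map_is_additive : zmod_morphism (env_map f).
Proof. exact: tlift_is_additive env_map_balanced. Qed.

Lemma env_mapE (x : A) (y : A^c) : env_map f (x ⊠ y) = (f x : A') ⊠ (f y : A'^c).
Proof. exact: tliftE env_map_balanced. Qed.

Lemma env_map_is_multiplicative : monoid_morphism (env_map f).
Proof.
split; first by rewrite -[1]/(1 ⊠ 1 : A ⊗ A^c) env_mapE -[f (1 : A^c)]/(f 1) !rmorph1.
move=> t u; have B := env_map_is_additive.
move: t; apply: ktens_ext => [t v|t v|x y].
- by rewrite mulrBl B.
- by rewrite B mulrBl.
move: u; apply: ktens_ext => [t v|t v|x' y'].
- by rewrite mulrBr B.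
- by rewrite B mulrBr.
rewrite ktensorM !env_mapE [RHS]ktensorM rmorphM; congr (_ ⊠ _).
exact: (rmorphM f).
Qed.

HB.instance Definition _ := GRing.isZmodMorphism.Build _ _ (env_map f) env_map_is_additive.
HB.instance Definition _ := GRing.isMonoidMorphism.Build _ _ (env_map f) env_map_is_multiplicative.
End EnvMap.

(* A as a module over its enveloping algebra: (a ⊠ a') x = a x a'. *)
Definition env_self (A : algType k) : Type := A.

Section EnvSelf.
Context (A : algType k).
HB.instance Definition _ := GRing.Zmodule.on (env_self A).

Definition env_self_scale (t : env A) (x : env_self A) : env_self A :=
  tlift (fun (a : A) (a' : A^c) => a * (x : A) * (a' : A) : A) t.

Lemma env_self_balanced (x : A) :
  balanced (fun (c : k) (x : A) => c *: x) (fun (c : k) (x : A^c) => c *: x)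
    (fun (a : A) (a' : A^c) => a * (x : A) * (a' : A) : A).
Proof.
split=> [a a' b|a b b'|c a b].
- by rewrite !mulrDl.
- by rewrite mulrDr.
- by rewrite -!scalerAl scalerAr.
Qed.

Lemma env_self_scaleE a a' x : env_self_scale (a ⊠ a') x = a * (x : A) * (a' : A).
Proof. exact: tliftE (env_self_balanced x). Qed.
Lemma env_self_scaleBl x : zmod_morphism (env_self_scale^~ x).
Proof. exact: tlift_is_additive (env_self_balanced x). Qed.
Lemma env_self_scaleBr t : zmod_morphism (env_self_scale t).
Proof.
move=> x y; move: t; apply: ktens_ext => [t u|t u|a a'].
- exact: env_self_scaleBl.
- by rewrite !env_self_scaleBl opprD addrACA -opprD.
- by rewrite !env_self_scaleE mulrBr mulrBl.
Qed.
Lemma env_self_scaleA t u x : env_self_scale t (env_self_scale u x) = env_self_scale (t * u) x.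
Proof.
have Bl := env_self_scaleBl; have Br := env_self_scaleBr.
move: t; apply: ktens_ext => [t v|t v|a a'].
- exact: Bl.
- by rewrite mulrBl Bl.
move: u; apply: ktens_ext => [t v|t v|b b'].
- by rewrite Bl Br.
- by rewrite mulrBr Bl.
by rewrite ktensorM !env_self_scaleE !mulrA.
Qed.
Lemma env_self_scale1 : left_id 1 env_self_scale.
Proof. by move=> x; rewrite env_self_scaleE mul1r mulr1. Qed.
Lemma env_self_scaleDr : right_distributive env_self_scale +%R.
Proof. by move=> t; apply: zmod_morphismD (env_self_scaleBr t). Qed.
Lemma env_self_scaleDl x : {morph env_self_scale^~ x : t u / t + u}.
Proof. exact: zmod_morphismD (env_self_scaleBl x). Qed.
HB.instance Definition _ := GRing.Zmodule_isLmodule.Build (env A) (env_self A)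
  env_self_scaleA env_self_scale1 env_self_scaleDr env_self_scaleDl.
End EnvSelf.
End Enveloping.

Section QuotientModule.
Context (k : pzRingType) (V : lmodType k) (N : submodClosed V).

Definition lquot_rel (x y : V) : bool := x - y \in N.
Lemma lquot_rel_equiv : equiv_class_of lquot_rel.
Proof.
split=> [x|x y|y x z]; rewrite /lquot_rel ?subrr ?rpred0 //.
  by apply/idP/idP=> h; rewrite -opprB -scaleN1r rpredZ.
by move=> xy yz; rewrite -(subrK y x) -addrA rpredD.
Qed.
Canonical lquot_equivRel := EquivRelPack lquot_rel_equiv.

Definition lquot : Type := {eq_quot lquot_rel}.
HB.instance Definition _ := Choice.on lquot.
HB.instance Definition _ := EqQuotient.on lquot.

Lemma lquotP x y : reflect (\pi_lquot x = \pi_lquot y) (x - y \in N).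
Proof. by apply: (iffP idP) => [|/eqmodP]; first by move=> ?; apply/eqmodP. Qed.

Definition lquot_add (x y : lquot) : lquot := \pi_lquot (repr x + repr y).
Definition lquot_opp (x : lquot) : lquot := \pi_lquot (- repr x).
Definition lquot_scale (c : k) (x : lquot) : lquot := \pi_lquot (c *: repr x).

Lemma repr_lquot x : repr (\pi_lquot x) - x \in N.
Proof. by apply/lquotP; rewrite reprK. Qed.
Lemma lquot_addE x y : lquot_add (\pi_lquot x) (\pi_lquot y) = \pi_lquot (x + y).
Proof. by apply/lquotP; rewrite opprD addrACA rpredD ?repr_lquot. Qed.
Lemma lquot_oppE x : lquot_opp (\pi_lquot x) = \pi_lquot (- x).
Proof. by apply/lquotP; rewrite -opprD -[- (_ + _)]scaleN1r rpredZ ?repr_lquot. Qed.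
Lemma lquot_scaleE c x : lquot_scale c (\pi_lquot x) = \pi_lquot (c *: x).
Proof. by apply/lquotP; rewrite -scalerBr rpredZ ?repr_lquot. Qed.

Lemma lquot_ind (P : lquot -> Prop) : (forall x, P (\pi_lquot x)) -> forall x, P x.
Proof. by move=> h x; rewrite -[x]reprK. Qed.

Lemma lquot_addA : associative lquot_add.
Proof.
by elim/lquot_ind=> x; elim/lquot_ind=> y; elim/lquot_ind=> z; rewrite !lquot_addE addrA.
Qed.
Lemma lquot_addC : commutative lquot_add.
Proof. by elim/lquot_ind=> x; elim/lquot_ind=> y; rewrite !lquot_addE addrC. Qed.
Lemma lquot_add0 : left_id (\pi_lquot 0) lquot_add.
Proof. by elim/lquot_ind=> x; rewrite lquot_addE add0r. Qed.
Lemma lquot_addN : left_inverse (\pi_lquot 0) lquot_opp lquot_add.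
Proof. by elim/lquot_ind=> x; rewrite lquot_oppE lquot_addE addNr. Qed.
HB.instance Definition _ :=
  GRing.isZmodule.Build lquot lquot_addA lquot_addC lquot_add0 lquot_addN.

Lemma lquot_scaleA a b x : lquot_scale a (lquot_scale b x) = lquot_scale (a * b) x.
Proof. by elim/lquot_ind: x => x; rewrite !lquot_scaleE scalerA. Qed.
Lemma lquot_scale1 : left_id 1 lquot_scale.
Proof. by elim/lquot_ind=> x; rewrite lquot_scaleE scale1r. Qed.
Lemma lquot_scaleDr : right_distributive lquot_scale +%R.
Proof.
move=> c; elim/lquot_ind=> x; elim/lquot_ind=> y.
by rewrite [_ + _]lquot_addE !lquot_scaleE scalerDr [RHS]lquot_addE.
Qed.
Lemma lquot_scaleDl x : {morph lquot_scale^~ x : a b / a + b}.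
Proof.
by move=> a b; elim/lquot_ind: x => x; rewrite !lquot_scaleE scalerDl [RHS]lquot_addE.
Qed.
HB.instance Definition _ := GRing.Zmodule_isLmodule.Build k lquot
  lquot_scaleA lquot_scale1 lquot_scaleDr lquot_scaleDl.
End QuotientModule.

Section Cohomology.
Context (k : pzRingType) (C : nat -> lmodType k) (d : forall n, {linear C n -> C n.+1}).

Definition cocycle (n : nat) : {pred C n} := fun x => d n x == 0.
Lemma cocycle_submod n : GRing.submod_closed (@cocycle n).
Proof.
split=> [|c x y]; rewrite !unfold_in; first by rewrite linear0.
by move=> /eqP dx /eqP dy; rewrite linearP dx dy scaler0 addr0.
Qed.
HB.instance Definition _ n := GRing.isSubmodClosed.Build k (C n) (@cocycle n) (@cocycle_submod n).

Record cocycles (n : nat) : Type := Cocycle { cocycle_val : C n; _ : cocycle_val \in @cocycle n }.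
HB.instance Definition _ n := [isSub for @cocycle_val n].
HB.instance Definition _ n := [Choice of cocycles n by <:].
HB.instance Definition _ n := [SubChoice_isSubLmodule of cocycles n by <:].

Definition boundary (n : nat) : C n -> Prop :=
  if n is m.+1 then fun x : C m.+1 => exists y : C m, d m y = x else fun x => x = 0.

Definition coboundary (n : nat) : {pred cocycles n} := fun x => `[< boundary (val x) >].
Lemma coboundary_submod n : GRing.submod_closed (@coboundary n).
Proof.
split=> [|c x y /asboolP hx /asboolP hy]; apply/asboolP.
  by rewrite raddf0; case: n => //= n; exists 0; rewrite linear0.
rewrite linearP /=; case: n x y hx hy => [|n] x y /=.
  by move=> -> ->; rewrite scaler0 addr0.
by move=> [u <-] [v <-]; exists (c *: u + v); rewrite linearP.
Qed.
HB.instance Definition _ n :=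
  GRing.isSubmodClosed.Build k (cocycles n) (@coboundary n) (@coboundary_submod n).

Definition cohomology (n : nat) : lmodType k := lquot (@coboundary n).
End Cohomology.

Definition injective_module (R : pzRingType) (I : lmodType R) : Prop :=
  forall (X Y : lmodType R) (f : {linear X -> Y}) (g : {linear X -> I}),
    injective f -> exists h : {linear Y -> I}, forall x, h (f x) = g x.

Record injective_resolution (R : pzRingType) (M : lmodType R) := InjectiveResolution {
  res_obj :> nat -> lmodType R;
  res_d : forall n, {linear res_obj n -> res_obj n.+1};
  res_aug : {linear M -> res_obj 0};
  res_inj : forall n, injective_module (res_obj n);
  res_aug_inj : injective res_aug;
  res_exact0 : forall x, res_d 0 x = 0 <-> exists m, res_aug m = x;
  res_exact : forall n x, res_d n.+1 x = 0 <-> exists y, res_d n y = x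
}.

(* Hom_E(X, Y) for a k-algebra E, as a k-vector space: the subspace of E-linear
   maps in the space of all functions from X to Y. *)
Section HomSpace.
Context (k : fieldType) (E : algType k) (X : lmodType E).

Section OneTarget.
Context (Y : lmodType E).
Notation Yk := (restr (in_alg E : {rmorphism k -> E}) Y).

Definition is_hom : {pred X -> Yk} := fun f => `[< linear (f : X -> Y) >].
Lemma is_hom_submod : GRing.submod_closed is_hom.
Proof.
split=> [|c f g /asboolP hf /asboolP hg]; apply/asboolP.
  by move=> a x y; rewrite scaler0 addr0.
move=> a x y.
rewrite -[LHS]/(c%:A *: f (a *: x + y) + g (a *: x + y)).
rewrite -[X in _ = X]/(a *: (c%:A *: f x + g x) + (c%:A *: f y + g y)).
rewrite hf hg !scalerDr !scalerA -scalerAr -scalerAl mul1r mulr1.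
by rewrite [LHS]addrACA.
Qed.
HB.instance Definition _ := GRing.isSubmodClosed.Build k (X -> Yk) is_hom is_hom_submod.

Record hom : Type := Hom { hom_val :> X -> Yk; _ : hom_val \in is_hom }.
HB.instance Definition _ := [isSub for hom_val].
HB.instance Definition _ := [Choice of hom by <:].
HB.instance Definition _ := [SubChoice_isSubLmodule of hom by <:].
End OneTarget.

Lemma hom_post_subproof (Y Y' : lmodType E) (g : {linear Y -> Y'}) (f : hom Y) :
  (fun x => g (f x)) \in @is_hom Y'.
Proof. by case: f => f /asboolP /= hf; apply/asboolP=> a x y; rewrite hf linearP. Qed.

Definition hom_post (Y Y' : lmodType E) (g : {linear Y -> Y'}) (f : hom Y) : hom Y' :=
  Hom (hom_post_subproof g f).

Lemma hom_post_is_linear (Y Y' : lmodType E) (g : {linear Y -> Y'}) : linear (hom_post g).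
Proof.
move=> c f f'; apply: val_inj; apply/funext => x /=.
exact: (linearP g c%:A (f x) (f' x)).
Qed.
HB.instance Definition _ (Y Y' : lmodType E) (g : {linear Y -> Y'}) :=
  GRing.isLinear.Build k (hom Y) (hom Y') _ (hom_post g) (hom_post_is_linear g).
End HomSpace.

(* The value at M of the q-th right derived functor of Hom_E(X, -), computed
   from the injective resolution I of M: the cohomology of the complex
   Hom_E(X, I 0) -> Hom_E(X, I 1) -> ... in degree q. *)
Definition right_derived_hom (k : fieldType) (E : algType k) (X M : lmodType E)
    (I : injective_resolution M) (q : nat) : lmodType k :=
  cohomology (fun n => hom_post (res_d I n) : {linear hom X (I n) -> hom X (I n.+1)}) q.

Definition hochschild (k : fieldType) (B : algType k) (N : lmodType (env B))
    (I : injective_resolution N) (q : nat) : lmodType k :=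
  right_derived_hom (env_self B) I q.

(* V is a right H-module with respect to act, compatibly with its k-structure. *)
Definition right_action (k : fieldType) (H : algType k) (V : lmodType k)
    (act : V -> H -> V) : Prop :=
  [/\ forall h, linear (act^~ h),
      forall v, linear (act v),
      forall v, act v 1 = v &
      forall v g h, act (act v g) h = act v (g * h)].

Definition restrict_bimodule (k : fieldType) (H : weakHopfType k) (A : comodAlgType H)
    (M : lmodType (env A)) : lmodType (env (coinv A)) :=
  restr (env_map (@coinv_incl k H A) : {rmorphism env (coinv A) -> env A}) M.

(* Main.v *)
Require Import Defs.
From HB Require Import structures.
From mathcomp Require Import all_boot all_algebra.
From mathcomp Require Import boolp classical_sets functions.

(* For an A-A-bimodule N the group Hom_{B^e}(B, N) is the set of B-central
   elements of N.  Writing κ(h) = κ^1(h) ⊗ κ^2(h) for the translation map, the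
   Miyashita-Ulbrich action n·h = κ^1(h) n κ^2(h) makes it a right H-module,
   naturally in N: every identity needed holds in A ⊗_B A because it holds after
   applying the injective map can.  To reach higher degrees, embed M in coinduced
   modules Hom_k(A^e, V) to get a resolution J of M by A^e-modules.  Since A is
   flat on both sides over B, the functor A ⊗_B - ⊗_B A preserves injections, and
   maps of B^e-modules X -> Hom_k(A^e, V) are the k-linear maps from
   A ⊗_B X ⊗_B A to V; hence J restricts to an injective resolution over B^e.
   The action on Hom_{B^e}(B, J) passes to cohomology and is carried over to the
   given resolution I by the homotopy equivalence between I and J. *)

Set Implicit Arguments.
Unset Strict Implicit.
Unset Printing Implicit Defensive.

Import GRing.Theory.
Local Open Scope ring_scope.
Local Open Scope quotient_scope.

(** * Extension of linear maps over a field *)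

Lemma linear_bundle (R : pzRingType) (X Y : lmodType R) (f : X -> Y) :
  linear f -> exists g : {linear X -> Y}, forall x, g x = f x.
Proof.
move=> fl; pose hf := GRing.isLinear.Build R X Y _ f fl.
by exists (HB.pack f hf : {linear X -> Y}).
Qed.

Section LinearExtension.
Local Open Scope classical_set_scope.
Context (k : fieldType) (U W V : lmodType k).

(** Zorn's lemma yields a maximal subspace meeting the image of [i] trivially; maximality makes it a
    complement of that image. *)
Lemma subspace_complement (i : {linear U -> W}) :
  exists C : set W, [/\ forall a x y, C x -> C y -> C (a *: x + y),
    forall u, C (i u) -> i u = 0 & forall w, exists u, C (w - i u)].
Proof.
(* [P] does not ask for 0, since Zorn's lemma also covers the empty chain, whose union is the empty
   set; 0 is recovered from maximality. *)
pose P (C : set W) := (forall a x y, C x -> C y -> C (a *: x + y)) /\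
  (forall u, C (i u) -> i u = 0).
have [F FP Ftot|C [[Clin Ci] Cmax]] := @Zorn_bigcup W P.
  split=> [a x y [X FX Xx] [Y FY Yy]|u [X FX Xu]]; last by case: (FP _ FX) => _; exact.
  have [XY|YX] := Ftot _ _ FX FY.
    by exists Y => //; apply: (FP _ FY).1 => //; apply: XY.
  by exists X => //; apply: (FP _ FX).1 => //; apply: YX.
have C0 : C 0.
  apply: contrapT => C0; apply: (Cmax [set 0]).
    split=> [x Cx|sub]; last by apply: C0; apply: sub.
    by exfalso; apply: C0; rewrite -(addNr x) -scaleN1r; apply: Clin.
  by split=> [a x y -> ->|u //]; rewrite /= scaler0 addr0.
have CZ a x : C x -> C (a *: x) by move=> Cx; rewrite -[_ *: _]addr0; apply: Clin.
have CD x y : C x -> C y -> C (x + y) by move=> Cx Cy; rewrite -[x]scale1r; apply: Clin.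
exists C; split=> // w; apply: contrapT => /forallNP nC.
(* [C'] is C + kw. If it contained a non-zero [i u], dividing by the coefficient of w would write w
   as an element of C plus one of the image of [i], against [nC]. *)
pose C' := [set z | exists a, C (z - a *: w)].
apply: (Cmax C').
  split=> [z Cz|C'C]; first by exists 0; rewrite scale0r subr0.
  apply: (nC 0); rewrite linear0 subr0; apply: C'C.
  by exists 1; rewrite scale1r subrr.
split=> [a y z [b Cy] [c Cz]|u [a Ca]].
  exists (a * b + c); rewrite scalerDl -scalerA opprD addrACA -scalerBr.
  exact: Clin.
have [a0|a0] := eqVneq a 0; first by apply: Ci; rewrite a0 scale0r subr0 in Ca.
exfalso; apply: (nC (a^-1 *: u)); have := CZ (- a^-1) _ Ca.
rewrite scalerBr scalerA mulNr mulVf // !scaleNr scale1r opprK addrC.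
by rewrite -[a^-1 *: i u]linearZ.
Qed.

(** The extension is [g] composed with the projection of W onto U along a complement of the image of
    [i]. *)
Lemma linear_extension (i : {linear U -> W}) (g : {linear U -> V}) :
  injective i -> exists h : {linear W -> V}, forall u, h (i u) = g u.
Proof.
move=> i_inj; have [C [Clin Ci Cdec]] := subspace_complement i.
pose r w := projT1 (cid (Cdec w)).
have rP w : C (w - i (r w)) by rewrite /r; case: cid.
have CB x y : C x -> C y -> C (x - y).
  by move=> Cx Cy; rewrite addrC -scaleN1r; apply: Clin.
have r_uniq w u : C (w - i u) -> r w = u.
  move=> Cu; apply/eqP; rewrite -subr_eq0; apply/eqP/i_inj; rewrite linear0; apply: Ci.
  have := CB _ _ Cu (rP w).
  by rewrite opprB addrC addrA subrK -linearB.
have r_lin : linear r.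
  move=> a x y; apply: r_uniq; rewrite linearP opprD addrACA -scalerBr.
  exact: Clin.
have [h hE] := @linear_bundle k W V (fun w => g (r w))
  (fun a x y => etrans (congr1 g (r_lin a x y)) (linearP g a (r x) (r y))).
exists h => u; rewrite hE; congr (g _); apply: r_uniq; rewrite subrr.
by have := CB _ _ (rP 0) (rP 0); rewrite subrr.
Qed.
End LinearExtension.

(** * Comparison of injective resolutions *)

Section Comparison.
Context (R : pzRingType).

Section ExtendThroughKernel.
Context (X Y : lmodType R) (d : {linear X -> Y}).

Definition lker_pred : {pred X} := fun x => d x == 0.
Lemma lker_submod : GRing.submod_closed lker_pred.
Proof.
split=> [|a x y]; rewrite !unfold_in; first by rewrite linear0.
by move=> /eqP dx /eqP dy; rewrite linearP dx dy scaler0 addr0.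
Qed.
HB.instance Definition _ := GRing.isSubmodClosed.Build R X lker_pred lker_submod.

(** Both [d] and [g] factor through X / ker d, where [d] becomes injective, so the injectivity of J
    applies. *)
Lemma injective_extension (J : lmodType R) (g : {linear X -> J}) :
  injective_module J -> (forall x, d x = 0 -> g x = 0) ->
  exists h : {linear Y -> J}, forall x, h (d x) = g x.
Proof.
move=> injJ dg; pose Q : lmodType R := lquot lker_pred.
have repr_ker x : d (repr (\pi_Q x) - x) = 0.
  by apply/eqP; have := repr_lquot lker_pred x; rewrite unfold_in.
have lift_linear (Z : lmodType R) (f : {linear X -> Z}) :
  (forall x, d x = 0 -> f x = 0) -> exists f' : {linear Q -> Z}, forall x, f' (\pi_Q x) = f x.
  move=> df; have fpi x : f (repr (\pi_Q x)) = f x.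
    by apply/eqP; rewrite -subr_eq0 -linearB df.
  have [|f' f'E] := @linear_bundle R Q Z (fun x => f (repr x)).
    move=> a; elim/lquot_ind=> x; elim/lquot_ind=> y.
    rewrite -[a *: _]/(lquot_scale _ _) lquot_scaleE -[_ + _]/(lquot_add _ _) lquot_addE.
    by rewrite !fpi linearP.
  by exists f' => x; rewrite f'E.
have [d' d'E] := lift_linear _ d (fun x dx => dx).
have [g' g'E] := lift_linear _ g dg.
have [|h hE] := injJ Q Y d' g'; last by exists h => x; rewrite -d'E hE.
elim/lquot_ind=> x; elim/lquot_ind=> y; rewrite !d'E => dxy.
by apply/lquotP; rewrite unfold_in linearB dxy subrr.
Qed.
End ExtendThroughKernel.

Context (M : lmodType R).
Implicit Types I J : injective_resolution M.

Lemma res_dd I n x : res_d I n.+1 (res_d I n x) = 0.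
Proof. by apply/res_exact; exists x. Qed.

Lemma res_d_aug I x : res_d I 0 (res_aug I x) = 0.
Proof. by apply/res_exact0; exists x. Qed.

Lemma comparison_exists I J : exists phi : forall n, {linear I n -> J n},
  (forall m, phi 0%N (res_aug I m) = res_aug J m) /\
  (forall n x, phi n.+1 (res_d I n x) = res_d J n (phi n x)).
Proof.
(* Invariant of the recursion: the map built so far sends cocycles to cocycles, so its composite
   with [res_d J n] kills the kernel of [res_d I n] and extends along [res_d I n]. *)
pose good n (f : {linear I n -> J n}) := forall x, res_d I n x = 0 -> res_d J n (f x) = 0.
have [f0 f0E] : exists f0 : {linear I 0%N -> J 0%N}, forall m, f0 (res_aug I m) = res_aug J m.
  exact: (@res_inj _ _ J 0%N _ _ (res_aug I) (res_aug J) (@res_aug_inj _ _ I)).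
have good0 : good 0%N f0.
  by move=> x /res_exact0[m <-]; rewrite f0E res_d_aug.
have step n (f : {f | good n f}) : {g : {f | good n.+1 f} |
    forall x, projT1 g (res_d I n x) = res_d J n (projT1 f x)}.
  apply: cid; case: f => f fgood /=.
  have [|g gE] := @injective_extension _ _ (res_d I n) _ (res_d J n \o f) (@res_inj _ _ J n.+1).
    exact: fgood.
  have ggood : good n.+1 g by move=> _ /res_exact[x <-]; rewrite gE /= res_dd.
  by exists (exist _ g ggood).
pose phi := fix phi n : {f | good n f} :=
  if n is m.+1 then projT1 (step m (phi m)) else exist _ f0 good0.
exists (fun n => projT1 (phi n)); split=> // n x /=.
exact: (projT2 (step n (phi n))).
Qed.

(** Meant for the difference between a composite of two comparison maps and the identity, which
    vanishes on the augmentation. *)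
Lemma comparison_homotopy I J (delta : forall n, {linear I n -> J n}) :
  (forall m, delta 0%N (res_aug I m) = 0) ->
  (forall n x, delta n.+1 (res_d I n x) = res_d J n (delta n x)) ->
  exists s : forall n, {linear I n.+1 -> J n},
    (forall x, delta 0%N x = s 0%N (res_d I 0 x)) /\
    (forall n x, delta n.+1 x = s n.+1 (res_d I n.+1 x) + res_d J n (s n x)).
Proof.
move=> d_aug d_chain.
(* On cocycles the term [s n.+1 (res_d I n.+1 x)] drops out of the homotopy relation. What remains
   is [good], and it is exactly what lets [delta n.+1] minus [res_d J n \o s] factor through
   [res_d I n.+1]. *)
pose good n (s : {linear I n.+1 -> J n}) := forall x, res_d I n.+1 x = 0 ->
  delta n.+1 x = res_d J n (s x).
have [s0 s0E] : exists s0 : {linear I 1%N -> J 0%N}, forall x, s0 (res_d I 0 x) = delta 0%N x.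
  by apply: injective_extension (@res_inj _ _ J 0%N) _ => _ /res_exact0[m <-].
have good0 : good 0%N s0 by move=> _ /res_exact[x <-]; rewrite d_chain s0E.
have step n (s : {s | good n s}) : {t : {s | good n.+1 s} | forall x,
    delta n.+1 x = projT1 t (res_d I n.+1 x) + res_d J n (projT1 s x)}.
  apply: cid; case: s => s sgood /=.
  have [x dx|t tE] := @injective_extension _ _ (res_d I n.+1) _
      (delta n.+1 \- (res_d J n \o s)) (@res_inj _ _ J n.+1).
    by rewrite /= (sgood x dx) subrr.
  have tgood : good n.+1 t.
    by move=> _ /res_exact[x <-]; rewrite tE /= d_chain linearB res_dd subr0.
  by exists (exist _ t tgood) => x /=; rewrite tE /= subrK.
pose s := fix s n : {s | good n s} :=
  if n is m.+1 then projT1 (step m (s m)) else exist _ s0 good0.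
exists (fun n => projT1 (s n)); split=> // n x /=.
exact: (projT2 (step n (s n))).
Qed.
End Comparison.

(** * Actions on cohomology from operators on cochains *)

Section CohomologyAction.
Context (k : fieldType) (H : algType k) (C : nat -> lmodType k).
Context (d : forall n, {linear C n -> C n.+1}) (q : nat).

(** The module laws are asked only on cocycles and up to coboundaries, because an action carried
    over by a homotopy equivalence satisfies no more than that. *)
Lemma cohomology_right_action (op : H -> {linear C q -> C q}) :
  (forall x, linear (op^~ x)) ->
  (forall h x, d q x = 0 -> d q (op h x) = 0) ->
  (forall h x, boundary d x -> boundary d (op h x)) ->
  (forall x, d q x = 0 -> boundary d (op 1 x - x)) ->
  (forall g h x, d q x = 0 -> boundary d (op h (op g x) - op (g * h) x)) ->
  exists act : cohomology d q -> H -> cohomology d q, right_action act.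
Proof.
move=> op_lin op_cyc op_bnd op1 opM.
pose Z : lmodType k := cocycles d q; pose Q : lmodType k := cohomology d q.
have ZP (z : Z) : d q (val z) = 0 by apply/eqP; case: z.
have mem_op h (z : Z) : op h (val z) \in @cocycle _ _ d q.
  by rewrite unfold_in op_cyc ?ZP.
pose opZ h (z : Z) : Z := Cocycle (mem_op h z).
have piE (x y : Z) : boundary d (val x - val y) -> \pi_Q x = \pi_Q y.
  by move=> xy; apply/lquotP/asboolP; rewrite raddfB.
have reprE (z : Z) : boundary d (val (repr (\pi_Q z)) - val z).
  by have /asboolP := repr_lquot (@coboundary _ _ d q) z; rewrite raddfB.
have piopE h (z : Z) : \pi_Q (opZ h (repr (\pi_Q z))) = \pi_Q (opZ h z).
  by apply: piE; rewrite /= -linearB; apply/op_bnd/reprE.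
have piP a (x y : Z) : a *: \pi_Q x + \pi_Q y = \pi_Q (a *: x + y).
  rewrite -[a *: _]/(lquot_scale _ _) lquot_scaleE.
  by rewrite -[_ + _]/(lquot_add _ _) lquot_addE.
(* The operator is applied to the chosen representative of a class; [piopE] shows that any other
   cocycle in the class gives the same result. *)
exists (fun v h => \pi_Q (opZ h (repr v))); split.
- move=> h a; elim/lquot_ind=> x; elim/lquot_ind=> y.
  rewrite piP !piopE piP; congr (\pi_Q _); apply: val_inj => /=.
  by rewrite !linearP.
- elim/lquot_ind=> x a g h; rewrite !piopE piP; congr (\pi_Q _); apply: val_inj.
  by rewrite linearP /= op_lin.
- by elim/lquot_ind=> x; rewrite piopE; apply: piE; apply: op1.
- elim/lquot_ind=> x g h; rewrite (piopE g x) !piopE; apply: piE.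
  by have := opM g h _ (ZP x).
Qed.
End CohomologyAction.

(** * Coinduced modules *)

Section RestrictLinear.
Context (R S : pzRingType) (f : {rmorphism R -> S}) (X Y : lmodType S).
Context (g : {linear X -> Y}).
Definition restr_map : restr f X -> restr f Y := g.
Lemma restr_map_is_linear : linear restr_map.
Proof. by move=> a x y; rewrite [LHS](linearP g (f a) x y). Qed.
HB.instance Definition _ :=
  GRing.isLinear.Build R (restr f X) (restr f Y) _ restr_map restr_map_is_linear.
End RestrictLinear.

Lemma btens_ext (I : Type) (X Y W : zmodType) (r : I -> X -> X) (l : I -> Y -> Y)
    (F G : btens r l -> W) :
  zmod_morphism F -> zmod_morphism G ->
  (forall x y, F (tens r l x y) = G (tens r l x y)) -> F =1 G.
Proof.
move=> FB GB FG.
have F0 : F 0 = 0 by have := FB 0 0; rewrite !subrr.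
have G0 : G 0 = 0 by have := GB 0 0; rewrite !subrr.
have FD := zmod_morphismD FB; have GD := zmod_morphismD GB.
by elim/tens_ind=> [|x y t IHt]; rewrite ?F0 ?G0 // FD GD FG IHt.
Qed.

(* X ⊗_R Y for a D-module Y, as a module over a ring S that maps to D and whose
   image commutes with that of R. *)
Section BimoduleTensor.
Context (R S D : pzRingType) (i : {rmorphism R -> D}) (j : {rmorphism S -> D}).
Hypothesis ij_comm : forall r s, i r * j s = j s * i r.

Section Structure.
Context (X : lmodType R^c) (Y : lmodType D).

(** The commutation proof is an argument of the type, so that the type determines [j] and the
    S-module structure can be attached to it. *)
Definition bitens of (forall r s, i r * j s = j s * i r) : Type := mtens X (restr i Y).
Local Notation T := (bitens ij_comm).
HB.instance Definition _ := GRing.Zmodule.on T.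

Definition bitensor (x : X) (y : Y) : T := mtensor x (y : restr i Y).

Let tens_bal := @tens_balanced R X (restr i Y)
  (fun r x => (r : R^c) *: x) (fun r y => r *: y).

Lemma bitensorDl x x' y : bitensor (x + x') y = bitensor x y + bitensor x' y.
Proof. by have [h _ _] := tens_bal; exact: h. Qed.
Lemma bitensorDr x y y' : bitensor x (y + y') = bitensor x y + bitensor x y'.
Proof. by have [_ h _] := tens_bal; exact: h. Qed.
Lemma bitensorM (r : R) x y : bitensor ((r : R^c) *: x) y = bitensor x (i r *: y).
Proof. by have [_ _ h] := tens_bal; exact: h. Qed.

Lemma bitens_scale_balanced (s : S) :
  balanced (fun (r : R) (x : X) => (r : R^c) *: x) (fun (r : R) (y : restr i Y) => r *: y)
    (fun x y => bitensor x (j s *: (y : Y))).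
Proof.
split=> [x x' y|x y y'|r x y]; rewrite ?bitensorDl //.
- by rewrite -[y + y']/((y : Y) + (y' : Y)) scalerDr bitensorDr.
- by rewrite bitensorM -[r *: y]/(i r *: (y : Y)) !scalerA ij_comm.
Qed.

Definition bitens_scale (s : S) : T -> T := tlift (fun x (y : Y) => bitensor x (j s *: y)).

Let scB s : zmod_morphism (bitens_scale s).
Proof. exact: tlift_is_additive (bitens_scale_balanced s). Qed.
Let scE s x y : bitens_scale s (bitensor x y) = bitensor x (j s *: y).
Proof. exact: tliftE (bitens_scale_balanced s). Qed.

Lemma bitens_scaleA a b t : bitens_scale a (bitens_scale b t) = bitens_scale (a * b) t.
Proof.
move: t; apply: btens_ext => [t u|t u|x y]; rewrite ?scB // -[tens _ _ x y]/(bitensor x y).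
by rewrite !scE scalerA rmorphM.
Qed.
Lemma bitens_scale1 : left_id 1 bitens_scale.
Proof.
apply: btens_ext => [t u|t u|x y]; rewrite ?scB // -[tens _ _ x y]/(bitensor x y).
by rewrite scE rmorph1 scale1r.
Qed.
Lemma bitens_scaleDr : right_distributive bitens_scale +%R.
Proof. by move=> s; apply: zmod_morphismD. Qed.
Lemma bitens_scaleDl t : {morph bitens_scale^~ t : a b / a + b}.
Proof.
move=> a b; move: t; apply: btens_ext => [t u|t u|x y].
- exact: scB.
- by rewrite !scB opprD addrACA.
- by rewrite -[tens _ _ x y]/(bitensor x y) !scE rmorphD scalerDl bitensorDr.
Qed.
HB.instance Definition _ := GRing.Zmodule_isLmodule.Build S T
  bitens_scaleA bitens_scale1 bitens_scaleDr bitens_scaleDl.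

Lemma bitensorZ (s : S) x y : s *: bitensor x y = bitensor x (j s *: y).
Proof. exact: scE. Qed.

Lemma bitens_ext (W : zmodType) (F G : T -> W) :
  zmod_morphism F -> zmod_morphism G ->
  (forall x y, F (bitensor x y) = G (bitensor x y)) -> F =1 G.
Proof. exact: btens_ext. Qed.

Section Lift.
Context (W : lmodType S) (f : X -> Y -> W).
Hypothesis fDl : forall x x' y, f (x + x') y = f x y + f x' y.
Hypothesis fDr : forall x y y', f x (y + y') = f x y + f x y'.
Hypothesis fM : forall (r : R) x y, f ((r : R^c) *: x) y = f x (i r *: y).
Hypothesis fZ : forall s x y, f x (j s *: y) = s *: f x y.

Lemma bitens_lift : exists F : {linear T -> W}, forall x y, F (bitensor x y) = f x y.
Proof.
have bal : balanced (fun (r : R) (x : X) => (r : R^c) *: x)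
    (fun (r : R) (y : restr i Y) => r *: y) f by split.
pose F : T -> W := tlift f.
have FB : zmod_morphism F := tlift_is_additive bal.
have FE x y : F (bitensor x y) = f x y := tliftE x (y : restr i Y) bal.
have [|F' F'E] := @linear_bundle S T W F; last by exists F' => x y; rewrite F'E.
move=> s t u; rewrite (zmod_morphismD FB); congr (_ + _); move: t {u}.
apply: bitens_ext => [t u|t u|x y].
- by rewrite scalerBr FB.
- by rewrite FB scalerBr.
- by rewrite bitensorZ !FE fZ.
Qed.
End Lift.
End Structure.

(** Flatness speaks of an additive map between tensor products. [bitens_lift] gives an S-linear map
    with the same values on pure tensors, hence the same function. *)
Lemma bitens_mapr (X : lmodType R^c) (Y Y' : lmodType D) (g : {linear Y -> Y'}) :
  flat_right X -> injective g ->
  exists F : {linear bitens X Y ij_comm -> bitens X Y' ij_comm},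
    injective F /\ forall x y, F (bitensor x y) = bitensor x (g y).
Proof.
move=> flatX g_inj.
have [||||F FE] := @bitens_lift X Y _ (fun x y => bitensor x (g y)).
- by move=> *; rewrite bitensorDl.
- by move=> *; rewrite linearD bitensorDr.
- by move=> *; rewrite bitensorM linearZ.
- by move=> *; rewrite bitensorZ linearZ.
exists F; split=> //; have := flatX _ _ (restr_map g : {linear restr i Y -> restr i Y'}) g_inj.
set G := tlift _ => G_inj.
suff FG : F =1 G by move=> t u; rewrite !FG; apply: G_inj.
have bal : balanced (fun (b : R) (x : X) => (b : R^c) *: x)
   (fun (b : R) (y : restr i Y) => b *: y)
   (fun x y => mtensor x (@restr_map R D i Y Y' g y)).
  split=> *; first exact: bitensorDl.
    by rewrite linearD; apply: bitensorDr.
  by rewrite linearZ; apply: bitensorM.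
apply: bitens_ext => [t u|t u|x y]; rewrite ?linearB ?FE //.
  exact: tlift_is_additive.
by rewrite [RHS]tliftE.
Qed.

Lemma bitens_mapl (X X' : lmodType R^c) (Y : lmodType D) (g : {linear X -> X'}) :
  flat_left (restr i Y) -> injective g ->
  exists F : {linear bitens X Y ij_comm -> bitens X' Y ij_comm},
    injective F /\ forall x y, F (bitensor x y) = bitensor (g x) y.
Proof.
move=> flatY g_inj.
have [||||F FE] := @bitens_lift X Y _ (fun x y => bitensor (g x) y).
- by move=> *; rewrite linearD bitensorDl.
- by move=> *; rewrite bitensorDr.
- by move=> *; rewrite linearZ bitensorM.
- by move=> *; rewrite bitensorZ.
exists F; split=> //; have := flatY _ _ g g_inj.
set G := tlift _ => G_inj.
suff FG : F =1 G by move=> t u; rewrite !FG; apply: G_inj.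
have bal : balanced (fun (b : R) (x : X) => (b : R^c) *: x)
   (fun (b : R) (y : restr i Y) => b *: y)
   (fun x y => mtensor (g x) y).
  split=> *; first by rewrite linearD; apply: bitensorDl.
    exact: bitensorDr.
  by rewrite linearZ; apply: bitensorM.
apply: bitens_ext => [t u|t u|x y]; rewrite ?linearB ?FE //.
  exact: tlift_is_additive.
by rewrite [RHS]tliftE.
Qed.
End BimoduleTensor.

Section Coinduced.
Context (k : fieldType) (E : algType k) (V : lmodType k).

Definition is_klinear : {pred E -> V} := fun f => `[< linear f >].
Lemma is_klinear_zmod : zmod_closed is_klinear.
Proof.
split=> [|f g /asboolP fl /asboolP gl]; apply/asboolP=> a x y.
  by rewrite -[RHS]/(a *: 0 + 0) scaler0 addr0.
rewrite -[LHS]/(f (a *: x + y) - g (a *: x + y)) fl gl opprD addrACA -scalerBr.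
by [].
Qed.
HB.instance Definition _ := GRing.isZmodClosed.Build (E -> V) is_klinear is_klinear_zmod.

(** This is Hom_k(E, V); E will act on it by right translation of the argument. *)
Record coind : Type := Coind { coind_val :> E -> V; _ : coind_val \in is_klinear }.
HB.instance Definition _ := [isSub for coind_val].
HB.instance Definition _ := [Choice of coind by <:].
HB.instance Definition _ := [SubChoice_isSubZmodule of coind by <:].

Lemma coind_linear (f : coind) : linear f.
Proof. exact/asboolP/(valP f). Qed.

Lemma coindB (f : coind) : zmod_morphism f.
Proof.
by move=> x y; rewrite [x - y]addrC -[- y]scaleN1r coind_linear scaleN1r addrC.
Qed.

Lemma coind_scale_subproof (e : E) (f : coind) : (fun x => f (x * e)) \in is_klinear.
Proof. by apply/asboolP=> a x y; rewrite mulrDl -scalerAl coind_linear. Qed.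
Definition coind_scale (e : E) (f : coind) : coind := Coind (coind_scale_subproof e f).

Lemma coind_ext (f g : coind) : (forall x, f x = g x) -> f = g.
Proof. by move=> fg; apply/val_inj/funext. Qed.

Lemma coind_scaleA a b f : coind_scale a (coind_scale b f) = coind_scale (a * b) f.
Proof. by apply: coind_ext => x /=; rewrite mulrA. Qed.
Lemma coind_scale1 : left_id 1 coind_scale.
Proof. by move=> f; apply: coind_ext => x /=; rewrite mulr1. Qed.
Lemma coind_scaleDr : right_distributive coind_scale +%R.
Proof. by move=> e f g; apply: coind_ext. Qed.
Lemma coind_scaleDl f : {morph coind_scale^~ f : a b / a + b}.
Proof.
move=> a b; apply: coind_ext => x /=; rewrite mulrDr.
by have := coind_linear f 1 (x * a) (x * b); rewrite !scale1r.
Qed.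
HB.instance Definition _ := GRing.Zmodule_isLmodule.Build E coind
  coind_scaleA coind_scale1 coind_scaleDr coind_scaleDl.

End Coinduced.

(** An element n goes to the map sending x to x n, and evaluation at 1 recovers n. *)
Lemma coind_embedding (k : fieldType) (E : algType k) (N : lmodType E) :
  exists i : {linear N -> coind E (restr (in_alg E : {rmorphism k -> E}) N)}, injective i.
Proof.
pose V := restr (in_alg E : {rmorphism k -> E}) N.
have i_sub (n : N) : (fun x : E => x *: n : V) \in @is_klinear k E V.
  apply/asboolP=> a x y; rewrite scalerDl; congr (_ + _).
  by rewrite -[RHS]/(a%:A *: (x *: n)) scalerA -scalerAl mul1r.
have [|i iE] := @linear_bundle E N (coind E V) (fun n => Coind (i_sub n)).
  move=> a m n; apply: coind_ext => x /=.
  by rewrite -[RHS]/((x * a) *: m + x *: n) scalerDr scalerA.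
exists i => m n; rewrite !iE => /(congr1 (fun f : coind E V => f 1)) /=.
by rewrite !scale1r.
Qed.

(** * Injectivity of coinduced modules after restriction to B^e *)

Section CoindInjective.
Context (k : fieldType) (B A : algType k) (f : {lrmorphism B -> A}).

Lemma ktensorBl (X Y : lmodType k) (x x' : X) (y : Y) : (x - x') ⊠ y = x ⊠ y - x' ⊠ y.
Proof. by rewrite ktensorDl -scaleN1r ktensorZl scaleN1r. Qed.
Lemma ktensorBr (X Y : lmodType k) (x : X) (y y' : Y) : x ⊠ (y - y') = x ⊠ y - x ⊠ y'.
Proof. by rewrite ktensorDr -scaleN1r ktensorZr scaleN1r. Qed.

Definition env_inl (b : B) : env B := b ⊠ 1.
Definition env_inr (b : B^c) : env B := 1 ⊠ b.

Lemma env_inl_is_additive : zmod_morphism env_inl.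
Proof. by move=> x y; apply: ktensorBl. Qed.
Lemma env_inl_is_multiplicative : monoid_morphism env_inl.
Proof. by split=> // x y; rewrite [RHS]ktensorM mulr1. Qed.
HB.instance Definition _ := GRing.isZmodMorphism.Build _ _ env_inl env_inl_is_additive.
HB.instance Definition _ := GRing.isMonoidMorphism.Build _ _ env_inl env_inl_is_multiplicative.

Lemma env_inr_is_additive : zmod_morphism env_inr.
Proof. by move=> x y; apply: ktensorBr. Qed.
Lemma env_inr_is_multiplicative : monoid_morphism env_inr.
Proof. by split=> // x y; rewrite [RHS]ktensorM mulr1. Qed.
HB.instance Definition _ := GRing.isZmodMorphism.Build _ _ env_inr env_inr_is_additive.
HB.instance Definition _ := GRing.isMonoidMorphism.Build _ _ env_inr env_inr_is_multiplicative.

Lemma env_inl_inr (b : B) (b' : B^c) : env_inl b * env_inr b' = b ⊠ b'.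
Proof. by rewrite [LHS]ktensorM mulr1 mul1r. Qed.

Lemma env_inlr_comm (b : B) (b' : B^c) : env_inl b * env_inr b' = env_inr b' * env_inl b.
Proof. by rewrite env_inl_inr [RHS]ktensorM mulr1 mul1r. Qed.

Lemma in_alg_comm (b : B) (c : k) : f b * in_alg A c = in_alg A c * f b.
Proof. by rewrite /= -scalerAl -scalerAr mul1r mulr1. Qed.

Local Notation A_l := (restr f A^o).
Local Notation A_r := (restr (conv_map f : {rmorphism B^c -> A^c}) (A^c)^o).

(* A ⊗_B X as a right B-module, and A ⊗_B X ⊗_B A as a k-module. *)
Local Notation T1 X := (@bitens B B^c (env B) env_inl env_inr A_r X env_inlr_comm).
Local Notation T2 X := (@bitens B k A f (in_alg A) (T1 X) A^o in_alg_comm).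

Section Pure.
Context (X : lmodType (env B)).

Definition bitensor3 (a : A) (x : X) (a' : A) : T2 X :=
  bitensor in_alg_comm (bitensor env_inlr_comm (a : A_r) x) (a' : A^o).

Lemma bitensor3Dl a a' x c : bitensor3 (a + a') x c = bitensor3 a x c + bitensor3 a' x c.
Proof. by rewrite -bitensorDl -bitensorDl. Qed.
Lemma bitensor3Dm a x x' c : bitensor3 a (x + x') c = bitensor3 a x c + bitensor3 a x' c.
Proof. by rewrite -bitensorDl -bitensorDr. Qed.
Lemma bitensor3Dr a x c c' : bitensor3 a x (c + c') = bitensor3 a x c + bitensor3 a x c'.
Proof. by rewrite -bitensorDr. Qed.
Lemma bitensor3M b b' a x c :
  bitensor3 a ((b ⊠ b' : env B) *: x) c = bitensor3 (a * f b) x (f b' * c).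
Proof.
rewrite -env_inl_inr -scalerA /bitensor3 -bitensorM -[RHS]bitensorM.
by rewrite bitensorZ.
Qed.
Lemma bitensor3Zr s a x c : bitensor3 a x (s *: c) = s *: bitensor3 a x c.
Proof. by rewrite /bitensor3 bitensorZ /= -[_%:A *: _]scalerAl mul1r. Qed.
(** The field acts on the triple tensor product through the last factor. A scalar on the first
    factor gets there through X, since s1 ⊗ 1 = 1 ⊗ s1 in B^e. *)
Lemma bitensor3Zl s a x c : bitensor3 (s *: a) x c = s *: bitensor3 a x c.
Proof.
have := bitensor3M s%:A 1 a x c; rewrite rmorph1 mul1r linearZ /= rmorph1.
rewrite -scalerAr mulr1 => <-; rewrite -bitensor3Zr.
have := bitensor3M 1 s%:A a x c; rewrite rmorph1 mulr1 linearZ /= rmorph1.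
by rewrite -scalerAl mul1r => <-; rewrite ktensorZC.
Qed.

Context (V : lmodType k).

(** One direction of the adjunction between B^e-maps X -> Hom_k(A^e, V) and k-linear maps A ⊗_B X
    ⊗_B A -> V. *)
Lemma bitensor3_lift
    (g : {linear X -> restr (env_map f : {rmorphism env B -> env A}) (coind (env A) V)}) :
  exists G : {linear T2 X -> V}, forall a x (c : A), 
    G (bitensor3 a x c) = (g x : coind (env A) V) (a ⊠ (c : A^c)).
Proof.
pose g' x : coind (env A) V := g x.
have gB x : zmod_morphism (g' x) := coindB (g' x).
have gD x := zmod_morphismD (gB x).
have gM x b b' a (c : A) :
    g' ((b ⊠ b' : env B) *: x) (a ⊠ (c : A^c)) = g' x ((a * f b) ⊠ (f b' * c : A^c)).
  rewrite /g' linearZ -[LHS]/((g' x) ((a ⊠ (c : A^c)) * env_map f (b ⊠ b'))).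
  by rewrite env_mapE ktensorM.
have gZ x s t : g' x (s *: t) = s *: g' x t.
  have := coind_linear (g' x) s t 0.
  by rewrite (_ : g' x 0 = 0) ?addr0 // -(subrr 0) gB subrr.
(* First descend to A ⊗_B X with the right factor c fixed; the second lift then lets c vary. *)
pose phi (c : A) : T1 X -> V := tlift (fun (a : A_r) x => g' x ((a : A) ⊠ (c : A^c))).
have bal c : balanced (fun (r : B) (x : A_r) => (r : B^c) *: x)
   (fun (r : B) (x : restr env_inl X) => r *: x)
   (fun (a : A_r) x => g' x ((a : A) ⊠ (c : A^c))).
  split=> [a a' x|a x x'|b a x].
  - by rewrite ktensorDl gD.
  - by rewrite /g' linearD.
  - by rewrite -[b *: x]/((b ⊠ 1 : env B) *: (x : X)) gM rmorph1 mul1r.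
have phiB c : zmod_morphism (phi c) := tlift_is_additive (bal c).
have phiE c a x : phi c (bitensor env_inlr_comm a x) = g' x ((a : A) ⊠ (c : A^c)).
  exact: tliftE (bal c).
have [||||G GE] := @bitens_lift B k A f (in_alg A) in_alg_comm (T1 X) A^o V
    (fun t (c : A^o) => phi c t).
- by move=> t u c; rewrite (zmod_morphismD (phiB c)).
- move=> t c c'; move: t; apply: bitens_ext.
  + exact: phiB.
  + by move=> t u; rewrite !phiB opprD addrACA.
  + by move=> a x; rewrite !phiE -gD -ktensorDr.
- move=> b t c; move: t; apply: bitens_ext => [t u|t u|a x].
  + by rewrite scalerBr phiB.
  + exact: phiB.
  + by rewrite bitensorZ !phiE gM rmorph1 mulr1.
- move=> s t c; move: t; apply: bitens_ext => [t u|t u|a x].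
  + exact: phiB.
  + by rewrite phiB scalerBr.
  + by rewrite !phiE -gZ -ktensorZr /= -[_%:A *: _]scalerAl mul1r.
exists G => a x c; rewrite GE; exact: phiE.
Qed.
End Pure.

(** Right flatness of A handles A ⊗_B -, and left flatness then handles - ⊗_B A. *)
Lemma bitensor3_map (X Y : lmodType (env B)) (g : {linear X -> Y}) :
  flat_left A_l -> flat_right A_r -> injective g ->
  exists F : {linear T2 X -> T2 Y}, injective F /\
    forall a x c, F (bitensor3 a x c) = bitensor3 a (g x) c.
Proof.
move=> flat_l flat_r g_inj.
have [F1 [F1_inj F1E]] := bitens_mapr env_inlr_comm flat_r g_inj.
have [F2 [F2_inj F2E]] := @bitens_mapl _ _ _ _ _ in_alg_comm _ _ A^o F1 flat_l F1_inj.
by exists F2; split=> // a x c; rewrite F2E F1E.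
Qed.

(** The extension problem is transposed along the adjunction: G lives on A ⊗_B X ⊗_B A, which F
    embeds in A ⊗_B Y ⊗_B A, so G extends to a k-linear K, and K is transposed back. *)
Lemma coind_injective (V : lmodType k) : flat_left A_l -> flat_right A_r ->
  injective_module (restr (env_map f : {rmorphism env B -> env A}) (coind (env A) V)).
Proof.
move=> flat_l flat_r X Y i g i_inj.
have [F [F_inj FE]] := bitensor3_map flat_l flat_r i_inj.
have [G GE] := bitensor3_lift g.
have [K KE] := linear_extension G F_inj.
have bal y : balanced (fun (s : k) (a : A) => s *: a) (fun (s : k) (c : A^c) => s *: c)
    (fun a (c : A^c) => K (bitensor3 a y c)).
  split=> [a a' c|a c c'|s a c]; rewrite ?bitensor3Dl ?bitensor3Dr ?linearD //.
  by rewrite bitensor3Zl -bitensor3Zr.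
(* The transpose of K: y goes to the map sending a ⊗ c to K(a ⊗ y ⊗ c). *)
pose h0 y : env A -> V := tlift (fun a (c : A^c) => K (bitensor3 a y c)).
have h0B y : zmod_morphism (h0 y) := tlift_is_additive (bal y).
have h0E y a (c : A^c) : h0 y (a ⊠ c) = K (bitensor3 a y c) := tliftE a c (bal y).
have h0Dr z x y : h0 (x + y) z = h0 x z + h0 y z.
  move: z; apply: ktens_ext => [t u|t u|a c]; first exact: h0B.
    by rewrite !h0B opprD addrACA.
  by rewrite !h0E bitensor3Dm linearD.
have h0Br z : zmod_morphism (h0^~ z).
  by move=> x y; apply/eqP; rewrite eq_sym subr_eq -h0Dr subrK.
have h0_sub y : h0 y \in @is_klinear k (env A) V.
  apply/asboolP=> s t u; rewrite (zmod_morphismD (h0B y)); congr (_ + _).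
  move: t {u}; apply: ktens_ext => [t u|t u|a c].
  - by rewrite scalerBr h0B.
  - by rewrite h0B scalerBr.
  - by rewrite -ktensorZl !h0E bitensor3Zl linearZ.
pose h y : restr (env_map f : {rmorphism env B -> env A}) (coind (env A) V) :=
  Coind (h0_sub y).
have [|h' h'E] := @linear_bundle _ _ _ h.
  move=> e x y; apply: coind_ext => z.
  rewrite -[RHS]/(h0 x (z * env_map f e) + h0 y z) -[LHS]/(h0 (e *: x + y) z).
  rewrite (h0Dr z); congr (_ + _).
  move: e; apply: ktens_ext => [t u|t u|b b'].
  - by rewrite scalerBl h0Br.
  - by rewrite rmorphB mulrBr h0B.
  move: z; apply: ktens_ext => [v w|v w|a c]; first exact: h0B.
    by rewrite mulrBl h0B.
  by rewrite env_mapE ktensorM !h0E bitensor3M.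
exists h' => x; rewrite h'E; apply: coind_ext; apply: ktens_ext => [t u|t u|a c].
- exact: h0B.
- exact: coindB.
- by rewrite [LHS]h0E -FE KE GE.
Qed.
End CoindInjective.

(** * Cokernels and the resolution by coinduced modules *)

Section Cokernel.
Context (R : pzRingType) (X Y : lmodType R) (i : {linear X -> Y}).

Definition limg_pred : {pred Y} := fun y => `[< exists x, i x = y >].
Lemma limg_submod : GRing.submod_closed limg_pred.
Proof.
split=> [|a _ _ /asboolP[x <-] /asboolP[y <-]]; apply/asboolP.
  by exists 0; rewrite linear0.
by exists (a *: x + y); rewrite linearP.
Qed.
HB.instance Definition _ := GRing.isSubmodClosed.Build R Y limg_pred limg_submod.

Lemma cokernel : exists (Q : lmodType R) (p : {linear Y -> Q}),
  (forall z, exists y, p y = z) /\ (forall y, p y = 0 <-> exists x, i x = y).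
Proof.
pose Q : lmodType R := lquot limg_pred.
have [|p pE] := @linear_bundle R Y Q (\pi_Q).
  move=> a x y; apply: esym.
  rewrite -[a *: _]/(lquot_scale _ _) lquot_scaleE.
  by rewrite -[_ + _]/(lquot_add _ _) lquot_addE.
exists Q, p; split=> [|y]; first by elim/lquot_ind=> y; exists y.
rewrite pE -[0]/(\pi_Q 0); split=> [/lquotP/asboolP|iy].
  by rewrite subr0.
by apply/lquotP/asboolP; rewrite subr0.
Qed.
End Cokernel.

(** Embed the module in a coinduced one, pass to the cokernel and repeat. Each differential is a
    surjection onto a cokernel followed by the next embedding, which gives exactness. *)
Lemma coind_resolution (k : fieldType) (E : algType k) (M : lmodType E) :
  exists (V : nat -> lmodType k) (d : forall n, {linear coind E (V n) -> coind E (V n.+1)})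
    (aug : {linear M -> coind E (V 0%N)}),
  [/\ injective aug, forall x, d 0%N x = 0 <-> exists m, aug m = x &
    forall n x, d n.+1 x = 0 <-> exists y, d n y = x].
Proof.
pose V (N : lmodType E) : lmodType k := restr (in_alg E : {rmorphism k -> E}) N.
pose emb (N : lmodType E) : {linear N -> coind E (V N)} := projT1 (cid (coind_embedding N)).
have emb_inj N : injective (emb N) by rewrite /emb; case: cid.
pose Q (N : lmodType E) : lmodType E := projT1 (cid (cokernel (emb N))).
have pP N : exists p : {linear coind E (V N) -> Q N},
    (forall z, exists y, p y = z) /\ (forall y, p y = 0 <-> exists x, emb N x = y).
  by rewrite /Q; case: cid.
pose p N := projT1 (cid (pP N)).
have p_surj N z : exists y, p N y = z by rewrite /p; case: cid => ? [].
have p_ker N y : p N y = 0 <-> exists x, emb N x = y by rewrite /p; case: cid => ? [].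
(* The n-th cosyzygy of M. *)
pose N := fix N n : lmodType E := if n is m.+1 then Q (N m) else M.
have emb0 n x : emb (N n.+1) x = 0 <-> x = 0.
  by split=> [|->]; rewrite ?linear0 // => ex; apply: (emb_inj (N n.+1)); rewrite ex linear0.
exists (fun n => V (N n)), (fun n => emb (N n.+1) \o p (N n)), (emb (N 0%N)).
split=> [|x|n x]; first exact: (emb_inj M).
- by rewrite /= (emb0 0%N); apply: p_ker.
rewrite /= (emb0 n.+1); split=> [/p_ker[z <-]|[y <-]].
  by have [y <-] := p_surj (N n) z; exists y.
by apply/p_ker; exists (p (N n) y).
Qed.

(** * Coinvariants of a comodule algebra *)

Section TensorMaps.
Context (k : fieldType).
Implicit Types X Y Z V W : lmodType k.

Local Notation kbalanced f :=
  (balanced (fun (c : k) x => c *: x) (fun (c : k) y => c *: y) f).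

Lemma linear_fun0 X Y (f : X -> Y) : linear f -> f 0 = 0.
Proof. by move=> /linear_bundle[g gE]; rewrite -gE linear0. Qed.
Lemma linear_funB X Y (f : X -> Y) : linear f -> zmod_morphism f.
Proof. by move=> /linear_bundle[g gE] x y; rewrite -!gE linearB. Qed.

Lemma bilinear_balanced X Y W (f : X -> Y -> W) :
  (forall y, linear (f^~ y)) -> (forall x, linear (f x)) -> kbalanced f.
Proof.
move=> fl fr; split=> [x x' y|x y y'|c x y].
- by have := fl y 1 x x'; rewrite !scale1r.
- by have := fr x 1 y y'; rewrite !scale1r.
have f0y : f 0 y = 0 := linear_fun0 (fl y).
have fx0 : f x 0 = 0 := linear_fun0 (fr x).
by have := fl y c x 0; have := fr x c y 0; rewrite !addr0 f0y fx0 !addr0 => -> ->.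
Qed.

Lemma ktensor_linl X Y (y : Y) : linear (fun x : X => x ⊠ y).
Proof. by move=> c x x'; rewrite ktensorDl ktensorZl. Qed.
Lemma ktensor_linr X Y (x : X) : linear (fun y : Y => x ⊠ y).
Proof. by move=> c y y'; rewrite ktensorDr ktensorZr. Qed.

Lemma tlift_linear X Y W (f : X -> Y -> W) :
  (forall y, linear (f^~ y)) -> (forall x, linear (f x)) ->
  linear (tlift f : X ⊗ Y -> W).
Proof.
move=> fl fr; have bal := bilinear_balanced fl fr.
have FB : zmod_morphism (tlift f : X ⊗ Y -> W) := tlift_is_additive bal.
have F0 : tlift f (0 : X ⊗ Y) = 0 by have := FB 0 0; rewrite !subrr.
move=> c t u; rewrite (zmod_morphismD FB); congr (_ + _); move: t {u}.
apply: ktens_ext => [t u|t u|x y]; rewrite ?scalerBr ?FB ?scalerBr //.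
rewrite -ktensorZl ![tlift f _](tliftE _ _ bal).
have f0y : f 0 y = 0 := linear_fun0 (fl y).
by have := fl y c x 0; rewrite !addr0 f0y addr0.
Qed.

Lemma tlift_ktensor X Y W (f : X -> Y -> W) x y :
  (forall y, linear (f^~ y)) -> (forall x, linear (f x)) -> tlift f (x ⊠ y) = f x y.
Proof. by move=> fl fr; apply: tliftE; apply: bilinear_balanced. Qed.

Section Ktmap.
Context (X X' Y Y' : lmodType k) (f : X -> X') (g : Y -> Y').
Hypotheses (fl : linear f) (gl : linear g).
Let fgl y : linear (fun x => f x ⊠ g y).
Proof. by move=> c x x'; rewrite fl ktensor_linl. Qed.
Let fgr x : linear (fun y => f x ⊠ g y).
Proof. by move=> c y y'; rewrite gl ktensor_linr. Qed.
Lemma ktmap_linear : linear (ktmap f g).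
Proof. exact: tlift_linear. Qed.
Lemma ktmapE x y : ktmap f g (x ⊠ y) = f x ⊠ g y.
Proof. exact: tlift_ktensor. Qed.
End Ktmap.

Section Ktassoc.
Context (X Y Z : lmodType k).
Let inner_l (z : Z) (y : Y) : linear (fun x : X => x ⊠ (y ⊠ z)).
Proof. exact: ktensor_linl. Qed.
Let inner_r (z : Z) (x : X) : linear (fun y : Y => x ⊠ (y ⊠ z)).
Proof. by move=> c y y'; rewrite ktensor_linl ktensor_linr. Qed.
Let outer_l (z : Z) : linear (fun t : X ⊗ Y => tlift (fun x y => x ⊠ (y ⊠ z)) t).
Proof. exact: tlift_linear. Qed.
Let outer_r (t : X ⊗ Y) : linear (fun z : Z => tlift (fun x y => x ⊠ (y ⊠ z)) t).
Proof.
move=> c z z'; move: t; apply: ktens_ext => [t u|t u|x y].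
- by rewrite (linear_funB (outer_l _)).
- by rewrite !(linear_funB (outer_l _)) scalerBr opprD addrACA.
- by rewrite !tlift_ktensor // !ktensor_linr.
Qed.
Lemma ktassoc_linear : linear (@ktassoc k X Y Z).
Proof. exact: tlift_linear. Qed.
Lemma ktassocE (x : X) (y : Y) (z : Z) : ktassoc (x ⊠ y ⊠ z) = x ⊠ (y ⊠ z).
Proof.
apply: etrans (tlift_ktensor (x ⊠ y) z outer_l outer_r) _.
exact: (tlift_ktensor x y (inner_l z) (inner_r z)).
Qed.
End Ktassoc.
End TensorMaps.

(** * Coinvariants commute with the coaction of 1 *)

Section CoinvariantCommutation.
Context (k : fieldType) (H : weakHopfType k) (A : comodAlgType H).

Lemma scaler_linear (W : lmodType k) (c : k) : linear (fun w : W => c *: w).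
Proof. by move=> a w w'; rewrite scalerDr !scalerA mulrC. Qed.

(** At [comul 1] this gives [eps_t x]. The space W is left free so that the contraction also applies
    after a further comultiplication of the right leg. *)
Definition contract (x : H) (W : lmodType k) : H ⊗ W -> W :=
  tlift (fun u v => (counit (u * x) : k) *: v).

Section Contract.
Context (x : H) (W : lmodType k).
Let cl (w : W) : linear (fun u : H => (counit (u * x) : k) *: w).
Proof. by move=> c u v; rewrite mulrDl -scalerAl linearP scalerDl -scalerA. Qed.
Let cr (u : H) : linear (fun w : W => (counit (u * x) : k) *: w).
Proof. exact: scaler_linear. Qed.
Lemma contract_linear : linear (@contract x W).
Proof. exact: tlift_linear. Qed.
Lemma contractE u w : contract x (u ⊠ w : H ⊗ W) = (counit (u * x) : k) *: w.
Proof. exact: tlift_ktensor. Qed.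
End Contract.

Lemma eps_t_linear : linear (@eps_t k H).
Proof.
move=> c x y; rewrite /eps_t -![tlift _ _]/(contract _ _).
move: (comul 1); apply: ktens_ext => [t u|t u|u v].
- by rewrite (linear_funB (@contract_linear _ _)).
- by rewrite !(linear_funB (@contract_linear _ _)) scalerBr opprD addrACA.
- by rewrite !contractE mulrDr -scalerAr linearP scalerDl -scalerA.
Qed.

Lemma ktmap_id_comul_linear (V : lmodType k) :
  linear (ktmap id (comul : H -> H ⊗ H) : V ⊗ H -> V ⊗ (H ⊗ H)).
Proof. by apply: ktmap_linear => //; apply: linearP. Qed.
Lemma ktmap_id_comulE (V : lmodType k) (v : V) h :
  ktmap id (comul : H -> H ⊗ H) (v ⊠ h) = v ⊠ comul h.
Proof. by rewrite ktmapE //; apply: linearP. Qed.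

(** Contract the first leg of the identity (Δ ⊗ id)Δ(1) = (Δ(1) ⊗ 1)(1 ⊗ Δ(1)) against x, using
    coassociativity on the left side. *)
Lemma comul_eps_t (x : H) : comul (eps_t x) = (eps_t x ⊠ 1) * comul 1.
Proof.
have cB := linear_funB (@contract_linear x _).
have kB := linear_funB (@ktmap_id_comul_linear _).
have aB := linear_funB (@ktassoc_linear k _ _ _).
have e1 (t : H ⊗ H) : comul (contract x t) = contract x (ktmap id comul t).
  move: t; apply: ktens_ext => [t u|t u|u v].
  - by rewrite cB linearB.
  - by rewrite kB cB.
  - by rewrite ktmap_id_comulE !contractE linearZ.
have e2 (t s : H ⊗ H) :
    contract x (ktassoc (t ⊠ (1 : H)) * ((1 : H) ⊠ s)) = (contract x t ⊠ 1) * s.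
  move: t; apply: ktens_ext => [t u|t u|u v].
  - by rewrite ktensorBl aB mulrBl cB.
  - by rewrite cB ktensorBl mulrBl.
  by rewrite ktassocE ktensorM mulr1 !contractE ktensorZl -scalerAl.
by rewrite {1}/eps_t -[tlift _ _]/(contract x _) e1 -comulA comul1l e2.
Qed.

Let L (t : A ⊗ H) : A ⊗ (H ⊗ H) := ktmap id (fun h : H => h ⊠ (1 : H)) t.
Let L_linear : linear L.
Proof. by apply: ktmap_linear => // c h h'; rewrite ktensor_linl. Qed.
Let LE a h : L (a ⊠ h) = a ⊠ (h ⊠ 1).
Proof. by rewrite /L ktmapE // => c x x'; rewrite ktensor_linl. Qed.
Let LM t u : L (t * u) = L t * L u.
Proof.
have LB := linear_funB L_linear.
move: t; apply: ktens_ext => [t v|t v|a h].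
- by rewrite mulrBl LB.
- by rewrite LB mulrBl.
move: u; apply: ktens_ext => [t v|t v|a' h'].
- by rewrite mulrBr LB.
- by rewrite LB mulrBr.
by rewrite ktensorM !LE !ktensorM mulr1.
Qed.

Let Phi (t : A ⊗ H) : A ⊗ (H ⊗ H) := ktassoc (ktmap coact id t).
Let ktmap_coact_linear : linear (ktmap coact id : A ⊗ H -> _).
Proof. by apply: ktmap_linear => //; apply: linearP. Qed.
Let Phi_linear : linear Phi.
Proof.
move=> c t u; apply: etrans (congr1 _ (ktmap_coact_linear c t u)) _.
exact: ktassoc_linear.
Qed.
Let PhiE a h : Phi (a ⊠ h) = ktassoc (coact a ⊠ h).
Proof. by rewrite /Phi ktmapE //; apply: linearP. Qed.

Let Phi_mul b t : Phi ((b ⊠ 1) * t) = L (coact b) * Phi t.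
Proof.
have PB := linear_funB Phi_linear; have aB := linear_funB (@ktassoc_linear k _ _ _).
have LB := linear_funB L_linear.
move: t; apply: ktens_ext => [t u|t u|a h].
- by rewrite mulrBr PB.
- by rewrite PB mulrBr.
rewrite ktensorM mul1r !PhiE coactM; move: (coact b) (coact a) => s s'.
move: s; apply: ktens_ext => [t u|t u|x y].
- by rewrite mulrBl ktensorBl aB.
- by rewrite LB mulrBl.
move: s'; apply: ktens_ext => [t u|t u|x' y'].
- by rewrite mulrBr ktensorBl aB.
- by rewrite ktensorBl aB mulrBr.
by rewrite LE ktensorM !ktassocE !ktensorM mul1r.
Qed.

(** Contraction at 1 is ε ⊗ id, so [Chi] applies the counit to the middle factor of A ⊗ (H ⊗ H). It
    undoes both ρ ⊗ id and id ⊗ Δ. *)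
Let contract1 : H ⊗ H -> H := @contract 1 H.
Let Chi : A ⊗ (H ⊗ H) -> A ⊗ H := ktmap id contract1.
Let Chi_linear : linear Chi.
Proof. by apply: ktmap_linear => //; apply: contract_linear. Qed.
Let ChiE a t : Chi (a ⊠ t) = a ⊠ contract1 t.
Proof. by rewrite /Chi ktmapE //; apply: contract_linear. Qed.

Let Chi_Phi t : Chi (Phi t) = t.
Proof.
have PB := linear_funB Phi_linear; have aB := linear_funB (@ktassoc_linear k _ _ _).
have CB := linear_funB Chi_linear.
move: t; apply: ktens_ext => [t u|t u|a h]; rewrite ?PB ?CB //.
rewrite PhiE -[in RHS](coact_counit a).
have bl (y : H) : linear (fun x : A => (counit y : k) *: x) := scaler_linear _.
have br (x : A) : linear (fun y : H => (counit y : k) *: x).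
  by move=> c y y'; rewrite linearP scalerDl -scalerA.
have bB := linear_funB (tlift_linear bl br).
move: (coact a); apply: ktens_ext => [t u|t u|x y].
- by rewrite ktensorBl aB CB.
- by rewrite bB ktensorBl.
by rewrite ktassocE ChiE tlift_ktensor // /contract1 contractE mulr1 ktensorZr ktensorZl.
Qed.

Let Chi_comul b t : Chi (ktmap id comul t * (b ⊠ 1)) = t * (b ⊠ 1).
Proof.
have kB := linear_funB (@ktmap_id_comul_linear A).
have CB := linear_funB Chi_linear.
move: t; apply: ktens_ext => [t u|t u|a h].
- by rewrite kB mulrBl CB.
- by rewrite mulrBl.
rewrite ktmap_id_comulE !ktensorM !mulr1 ChiE; congr (_ ⊠ _).
rewrite -[RHS]counitl /contract1 /contract; congr (tlift _ _).
by apply/funext => u; apply/funext => v; rewrite mulr1.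
Qed.

(** Apply ρ ⊗ id to (b ⊗ 1)ρ(1). In the result b can be moved to the far right, because ρ(b) =
    ρ(1)(b ⊗ 1) and b commutes with 1 ⊗ Δ(1); the counit on the middle leg then returns ρ(1)(b ⊗ 1).
    This is what makes [can] balanced over B. *)
Lemma coinvariant_comm (b : A) : b \in @coinvariant k H A ->
  coact 1 * (b ⊠ 1) = (b ⊠ 1) * coact 1.
Proof.
move=> /coinvariantP b_coinv.
have coact1_eps : coact (1 : A) = ktmap id (@eps_t k H) (coact 1).
  by rewrite -coact1 mulr1.
(* By coassociativity the left side is (id ⊗ Δ)ρ(1). Since id ⊗ ε_t fixes ρ(1), [comul_eps_t]
   applies to its right leg. *)
have e : Phi (coact 1) = L (coact 1) * (1 ⊠ comul 1).
  rewrite /Phi coactA {1 2}coact1_eps.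
  have kB := linear_funB (@ktmap_id_comul_linear A).
  have tE (a : A) (h : H) : ktmap id (@eps_t k H) (a ⊠ h) = a ⊠ eps_t h.
    by rewrite ktmapE //; apply: eps_t_linear.
  have tB : zmod_morphism (ktmap id (@eps_t k H) : A ⊗ H -> A ⊗ H).
    by apply/linear_funB/ktmap_linear => //; apply: eps_t_linear.
  move: (coact 1); apply: ktens_ext => [t u|t u|a h].
  - by rewrite tB kB.
  - by rewrite tB (linear_funB L_linear) mulrBl.
  by rewrite tE ktmap_id_comulE comul_eps_t LE ktensorM mulr1.
apply: esym; rewrite -[LHS]Chi_Phi Phi_mul e mulrA -LM -coactM mulr1 b_coinv.
have bE : (b ⊠ (1 ⊠ 1)) * (1 ⊠ comul 1) = (1 ⊠ comul 1) * (b ⊠ 1) :> A ⊗ (H ⊗ H).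
  by rewrite !ktensorM mulr1 mul1r mul1r mulr1.
rewrite LM LE -mulrA bE mulrA -e /Phi coactA.
by rewrite [LHS]Chi_comul.
Qed.
End CoinvariantCommutation.

(** * The Miyashita-Ulbrich action *)

Section MiyashitaUlbrich.
Context (k : fieldType) (H : weakHopfType k) (A : comodAlgType H).
Hypothesis galoisA : weak_galois A.
Local Notation B := (coinv A).

Lemma coinv_inclP (b : B) : coinv_incl b \in @coinvariant k H A.
Proof. exact: valP. Qed.

(** Formal sums are used in place of elements of A ⊗_B A because the expression a n a' is balanced
    over B only when n is central. *)
Definition can_sum (s : seq (A * A)) : A ⊗ H := \sum_(p <- s) (p.1 ⊠ 1) * coact p.2.

Lemma can_balanced :
  balanced (fun (b : B) (x : A_right A) => (b : B^c) *: x)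
    (fun (b : B) (y : A_left A) => b *: y)
    (fun a a' : A => ((a ⊠ 1) * coact a' : A ⊗ H)).
Proof.
split=> [x x' y|x y y'|b x y].
- by rewrite ktensorDl mulrDl.
- by rewrite linearD mulrDr.
rewrite -[b *: y]/(coinv_incl b * (y : A)) -[_ *: x]/((x : A) * coinv_incl b).
have b_coinv := coinv_inclP b.
rewrite coactM (coinvariantP _ b_coinv) (coinvariant_comm b_coinv) -[_ * coact 1 * _]mulrA.
by rewrite -coactM mul1r mulrA ktensorM mulr1.
Qed.

Lemma can_pi s : can (\pi_(mtens (A_right A) (A_left A)) s) = can_sum s.
Proof. exact: tlift_pi can_balanced. Qed.

Lemma can_sum_surj (h : H) : exists s, can_sum s = (1 ⊠ h) * coact 1.
Proof.
case: galoisA => _ _ can_surj.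
have [|t _ <-] := can_surj ((1 ⊠ h) * coact 1); first by exists (1 ⊠ h).
by exists (repr t); rewrite -can_pi reprK.
Qed.

(* A list of pairs whose formal sum represents κ(h). *)
Definition translation (h : H) : seq (A * A) := projT1 (cid (can_sum_surj h)).

Lemma can_sum_translation h : can_sum (translation h) = (1 ⊠ h) * coact 1.
Proof. by rewrite /translation; case: cid. Qed.

Section Action.
Context (N : lmodType (env A)).
Implicit Types (n : N) (s : seq (A * A)).

Definition central n : Prop :=
  forall b : B, (coinv_incl b ⊠ (1 : A^c) : env A) *: n = (1 ⊠ (coinv_incl b : A^c) : env A) *: n.

Definition env_sum s n : N := \sum_(p <- s) (p.1 ⊠ (p.2 : A^c) : env A) *: n.

Lemma env_sum_balanced n : central n ->
  balanced (fun (b : B) (x : A_right A) => (b : B^c) *: x)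
    (fun (b : B) (y : A_left A) => b *: y)
    (fun a a' : A => (a ⊠ (a' : A^c) : env A) *: n).
Proof.
move=> n_central; split=> [x x' y|x y y'|b x y].
- by rewrite ktensorDl scalerDl.
- by rewrite -scalerDl -ktensorDr.
rewrite -[b *: y]/(coinv_incl b * (y : A)) -[_ *: x]/((x : A) * coinv_incl b).
have := congr1 (fun m => (x : A) ⊠ ((y : A) : A^c) *: m) (n_central b).
by rewrite !scalerA !ktensorM !mulr1.
Qed.

(** For central n the sum factors through A ⊗_B A, where [can] is injective. Identities about the
    action can therefore be checked in A ⊗ H. *)
Lemma env_sum_eq n s s' : central n -> can_sum s = can_sum s' -> env_sum s n = env_sum s' n.
Proof.
move=> /env_sum_balanced bal; rewrite -!can_pi => can_ss'.
case: galoisA => _ can_inj _; have := can_inj _ _ _ _ can_ss'.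
rewrite !inE => /(_ I I) ss'.
by have := congr1 (tlift (fun a a' : A => (a ⊠ (a' : A^c) : env A) *: n)) ss'; rewrite !tlift_pi.
Qed.

Definition mu n (h : H) : N := env_sum (translation h) n.

Lemma muE n h s : central n -> can_sum s = (1 ⊠ h) * coact 1 -> mu n h = env_sum s n.
Proof. by move=> n_central sE; apply: env_sum_eq; rewrite // can_sum_translation. Qed.

(** It amounts to b κ(h) = κ(h) b in A ⊗_B A. Under [can] the two sides become (b ⊗ 1)(1 ⊗ h)ρ(1)
    and (1 ⊗ h)ρ(b), which agree by [coinvariant_comm]. *)
Lemma mu_central n h : central n -> central (mu n h).
Proof.
move=> n_central b; rewrite /mu /env_sum !scaler_sumr.
set s := translation h.
transitivity (env_sum [seq (coinv_incl b * p.1, p.2) | p <- s] n).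
  rewrite /env_sum big_map; apply: eq_bigr => p _.
  by rewrite scalerA ktensorM mul1r.
transitivity (env_sum [seq (p.1, p.2 * coinv_incl b) | p <- s] n); last first.
  rewrite /env_sum big_map; apply: eq_bigr => p _.
  by rewrite scalerA ktensorM mul1r.
apply: env_sum_eq => //; rewrite /can_sum !big_map /=.
transitivity ((coinv_incl b ⊠ 1) * can_sum s).
  by rewrite mulr_sumr; apply: eq_bigr => p _; rewrite mulrA ktensorM mulr1.
transitivity (can_sum s * coact (coinv_incl b)); last first.
  by rewrite mulr_suml; apply: eq_bigr => p _; rewrite coactM mulrA.
have b_coinv := coinv_inclP b.
rewrite can_sum_translation -[RHS]mulrA -coactM mul1r (coinvariantP _ b_coinv).
by rewrite (coinvariant_comm b_coinv) !mulrA !ktensorM !mulr1 !mul1r.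
Qed.

(** κ(1) is represented by 1 ⊗ 1. *)
Lemma mu1 n : central n -> mu n 1 = n.
Proof.
move=> n_central; rewrite (muE (s := [:: (1, 1)])) ?/can_sum ?/env_sum ?big_seq1 //.
exact: scale1r.
Qed.

(** The underlying identity is κ(gh) = κ^1(h)κ^1(g) ⊗ κ^2(g)κ^2(h). *)
Lemma muM n g h : central n -> mu (mu n g) h = mu n (g * h).
Proof.
move=> n_central.
rewrite (muE (s := [seq (u.1 * t.1, t.2 * u.2) | u <- translation h, t <- translation g])
    (h := g * h)) //.
  rewrite /mu /env_sum big_allpairs_dep; apply: eq_bigr => u _.
  by rewrite scaler_sumr; apply: eq_bigr => t _; rewrite scalerA ktensorM.
rewrite /can_sum big_allpairs_dep /=.
(* The inner sum over κ(g) collapses to (1 ⊗ g)ρ(1); its factor 1 ⊗ g commutes with [u.1 ⊠ 1], and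
   ρ(1) is absorbed by [coact u.2]. *)
transitivity (\sum_(u <- translation h) (1 ⊠ g) * ((u.1 ⊠ 1) * coact u.2)).
  apply: eq_bigr => u _.
  transitivity ((u.1 ⊠ 1) * can_sum (translation g) * coact u.2).
    rewrite mulr_sumr mulr_suml; apply: eq_bigr => t _.
    by rewrite coactM !mulrA ktensorM mulr1.
  rewrite can_sum_translation -!mulrA -coactM mul1r !mulrA !ktensorM.
  by rewrite !mulr1 !mul1r.
rewrite -mulr_sumr -/(can_sum (translation h)) can_sum_translation.
by rewrite mulrA ktensorM mul1r.
Qed.

Lemma mu_linearr n (c : k) g h : central n ->
  mu n (c *: g + h) = (c%:A : env A) *: mu n g + mu n h.
Proof.
move=> n_central.
rewrite (muE (s := [seq (c *: p.1, p.2) | p <- translation g] ++ translation h)) //.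
  rewrite /env_sum big_cat big_map scaler_sumr; congr (_ + _).
  by apply: eq_bigr => p _; rewrite scalerA -scalerAl mul1r ktensorZl.
rewrite /can_sum big_cat big_map /=.
under eq_bigr do rewrite ktensorZl -scalerAl.
rewrite -scaler_sumr -!/(can_sum _) !can_sum_translation.
by rewrite ktensorDr ktensorZr mulrDl scalerAl.
Qed.

Lemma mu_linearl (c : k) n n' h :
  mu ((c%:A : env A) *: n + n') h = (c%:A : env A) *: mu n h + mu n' h.
Proof.
rewrite /mu /env_sum scaler_sumr -big_split; apply: eq_bigr => p _ /=.
by rewrite scalerDr !scalerA -scalerAl -scalerAr mul1r mulr1.
Qed.
End Action.

Lemma mu_natural (N N' : lmodType (env A)) (g : {linear N -> N'}) n h :
  g (mu n h) = mu (g n) h.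
Proof. by rewrite /mu /env_sum linear_sum; apply: eq_bigr => p _; rewrite linearZ. Qed.

(** * The action on Hom_{B^e}(B, N) *)

Section HomAction.
Context (N : lmodType (env A)).
Local Notation Nr := (restrict_bimodule N).
Local Notation homB := (Defs.hom (env_self B) Nr).

Lemma hom_linear (f : homB) : linear f.
Proof. exact/asboolP/(valP f). Qed.

Lemma restrict_scale (b b' : B) (n : Nr) : (b ⊠ (b' : B^c) : env B) *: n =
  ((coinv_incl b) ⊠ (coinv_incl b' : A^c) : env A) *: (n : N).
Proof. by rewrite -[LHS]/(env_map _ _ *: (n : N)) env_mapE. Qed.

Lemma homE (f : homB) (b : B) :
  f b = ((coinv_incl b ⊠ (1 : A^c) : env A) *: (f (1 : B) : N) : N).
Proof.
have [g gE] := linear_bundle (hom_linear f).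
have -> : f b = g ((b ⊠ (1 : B^c) : env B) *: ((1 : B) : env_self B)).
  by rewrite gE; congr (f _); rewrite [RHS]env_self_scaleE !mulr1.
by rewrite linearZ [LHS]restrict_scale gE.
Qed.

(** f(b) is both b f(1) and f(1) b, as b = (b ⊗ 1)1 = (1 ⊗ b)1 in B. *)
Lemma hom1_central (f : homB) : central (f (1 : B) : N).
Proof.
move=> b; rewrite -homE.
have [g gE] := linear_bundle (hom_linear f).
have -> : f b = g (((1 : B) ⊠ (b : B^c) : env B) *: ((1 : B) : env_self B)).
  by rewrite gE; congr (f _); rewrite [RHS]env_self_scaleE !mul1r.
by rewrite linearZ [LHS]restrict_scale gE.
Qed.

Lemma hom_ext (f g : homB) : f (1 : B) = g (1 : B) -> f = g.
Proof.
move=> fg; apply/val_inj/funext => b; apply: etrans (homE f b) _.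
apply: etrans (esym (homE g b)).
exact: (congr1 (fun n : N => (coinv_incl b ⊠ (1 : A^c) : env A) *: n) fg).
Qed.

Lemma central_hom_subproof (n : N) : central n ->
  (fun b : env_self B => (coinv_incl b ⊠ (1 : A^c) : env A) *: n : Nr) \in
    @is_hom _ _ (env_self B) Nr.
Proof.
move=> n_central; apply/asboolP=> e x y.
pose F (b : env_self B) : Nr := (coinv_incl b ⊠ (1 : A^c) : env A) *: n.
rewrite -[LHS]/(F (e *: x + y)) -[RHS]/(e *: F x + F y).
have FD u v : F (u + v) = F u + F v.
  apply: etrans (scalerDl n (coinv_incl u ⊠ (1 : A^c)) (coinv_incl v ⊠ (1 : A^c))).
  by rewrite -ktensorDl -rmorphD.
rewrite FD; congr (_ + _); move: e {y}.
have FB : zmod_morphism F.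
  by move=> u v; apply/eqP; rewrite eq_sym subr_eq -FD subrK.
apply: ktens_ext => [t u|t u|b b'].
- by rewrite scalerBl FB.
- by rewrite scalerBl.
rewrite restrict_scale [_ *: x]env_self_scaleE /F scalerA ktensorM mulr1 !rmorphM.
(* Centrality turns the right multiplication by b' into a left one next to n. *)
have := congr1 (fun m => ((coinv_incl b * coinv_incl x) ⊠ (1 : A^c) : env A) *: m)
  (n_central b').
by rewrite !scalerA !ktensorM !mulr1 mul1r.
Qed.

Definition central_hom (n : N) (n_central : central n) : homB :=
  Defs.Hom (central_hom_subproof n_central).

Lemma central_hom1 n (n_central : central n) : central_hom n_central (1 : B) = n.
Proof. by rewrite /= rmorph1 scale1r. Qed.

Definition hom_act (f : homB) (h : H) : homB := central_hom (mu_central h (hom1_central f)).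

Lemma hom_act1 f h : hom_act f h (1 : B) = mu (f (1 : B) : N) h.
Proof. exact: central_hom1. Qed.

(** The scalars of the hom space act through B^e; after evaluation at 1 they act through A^e, as in
    the lemmas on [mu]. *)
Lemma homP1 (c : k) (f g : homB) :
  (c *: f + g) (1 : B) = ((c%:A : env A) *: (f (1 : B) : N) + g (1 : B) : N).
Proof.
rewrite -[LHS]/((c%:A : env B) *: f (1 : B) + g (1 : B)); congr (_ + _).
by rewrite -ktensorZl [LHS]restrict_scale -ktensorZl linearZ rmorph1.
Qed.

Lemma hom_right_action : right_action hom_act.
Proof.
split=> [h c f g|f c g h|f|f g h]; apply: hom_ext; rewrite ?homP1 ?hom_act1 ?homP1.
- exact: mu_linearl.
- exact: mu_linearr (hom1_central f).
- exact: mu1 (hom1_central f).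
- exact: muM (hom1_central f).
Qed.
End HomAction.

Definition restrict_map (N N' : lmodType (env A)) (g : {linear N -> N'}) :
  {linear restrict_bimodule N -> restrict_bimodule N'} := restr_map g.

(** Naturality holds for A^e-linear maps. Differentials of an arbitrary injective resolution over
    B^e need not be such, hence the detour through coinduced modules. *)
Lemma hom_act_natural (N N' : lmodType (env A)) (g : {linear N -> N'})
    (f : Defs.hom (env_self B) (restrict_bimodule N)) (h : H) :
  hom_post (restrict_map g) (hom_act f h) = hom_act (hom_post (restrict_map g) f) h.
Proof.
apply: hom_ext; rewrite hom_act1 -[LHS]/(g (hom_act f h (1 : B))) hom_act1.
exact: mu_natural.
Qed.
End MiyashitaUlbrich.

(** * Transport of the action to cohomology *)

Section DerivedHom.
Context (k : fieldType) (E : algType k) (X : lmodType E).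

Lemma hom_post_square (Y Y1 Y2 Z : lmodType E) (f : {linear Y -> Y1}) (f' : {linear Y1 -> Z})
    (g : {linear Y -> Y2}) (g' : {linear Y2 -> Z}) (c : Defs.hom X Y) :
  (forall y, f' (f y) = g' (g y)) -> hom_post f' (hom_post f c) = hom_post g' (hom_post g c).
Proof. by move=> fg; apply/val_inj/funext => x /=; apply: fg. Qed.

Context (M : lmodType E).
Implicit Types I J : injective_resolution M.
Local Notation dhom I n := (hom_post (res_d I n) : {linear Defs.hom X (I n) -> Defs.hom X (I n.+1)}).

Section ChainMap.
Context (I J : injective_resolution M) (phi : forall n, {linear I n -> J n}).
Hypothesis phi_chain : forall n x, phi n.+1 (res_d I n x) = res_d J n (phi n x).

Lemma hom_post_cocycle q (c : Defs.hom X (I q)) :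
  dhom I q c = 0 -> dhom J q (hom_post (phi q) c) = 0.
Proof.
move=> dc; apply: etrans (esym (hom_post_square c (phi_chain (n := q)))) _.
exact: etrans (congr1 (hom_post (phi q.+1)) dc) (linear0 (hom_post _)).
Qed.

Lemma hom_post_boundary q (c : Defs.hom X (I q)) :
  boundary (fun n => dhom I n) c -> boundary (fun n => dhom J n) (hom_post (phi q) c).
Proof.
case: q c => [|q] c /=; first by move=> ->; rewrite linear0.
by move=> [b <-]; exists (hom_post (phi q) b); apply: hom_post_square.
Qed.

(** On a cocycle the null-homotopy s leaves only the term [res_d J n (s n x)], so the image is the
    coboundary of s composed with the cocycle. *)
Lemma hom_post_null q (c : Defs.hom X (I q)) : (forall m, phi 0%N (res_aug I m) = 0) ->
  dhom I q c = 0 -> boundary (fun n => dhom J n) (hom_post (phi q) c).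
Proof.
move=> phi_aug dc; have [s [s0 sS]] := comparison_homotopy phi_aug phi_chain.
have dcE x : res_d I q (c x) = 0.
  by have := congr1 (fun f : Defs.hom X (I q.+1) => f x) dc.
(* In degree 0 the only coboundary is 0, and the homotopy relation has a single term, which vanishes
   on cocycles. *)
case: q c dc dcE => [|q] c dc dcE /=.
  by apply/val_inj/funext => x; rewrite /= s0 dcE linear0.
exists (hom_post (s q) c); apply/val_inj/funext => x /=.
by rewrite sS dcE linear0 add0r.
Qed.
End ChainMap.

(** The chain map psi phi - id vanishes on the augmentation, so [hom_post_null] applies to it. *)
Lemma hom_post_comparison I J (phi : forall n, {linear I n -> J n})
    (psi : forall n, {linear J n -> I n}) q (c : Defs.hom X (I q)) :
  (forall m, phi 0%N (res_aug I m) = res_aug J m) ->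
  (forall n x, phi n.+1 (res_d I n x) = res_d J n (phi n x)) ->
  (forall m, psi 0%N (res_aug J m) = res_aug I m) ->
  (forall n x, psi n.+1 (res_d J n x) = res_d I n (psi n x)) ->
  dhom I q c = 0 ->
  boundary (fun n => dhom I n) (hom_post (psi q) (hom_post (phi q) c) - c).
Proof.
move=> phi_aug phi_d psi_aug psi_d dc.
pose delta n : {linear I n -> I n} := (psi n \o phi n) \- idfun.
have -> : hom_post (psi q) (hom_post (phi q) c) - c = hom_post (delta q) c.
  by apply/val_inj/funext.
apply: hom_post_null => // [n x|m].
  by rewrite /= phi_d psi_d linearB.
by rewrite /= phi_aug psi_aug subrr.
Qed.
End DerivedHom.

Theorem proposition3p6 (k : fieldType) (H : weakHopfType k) (A : comodAlgType H)
    (antipode_bij : bijective (antipode : H -> H))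
    (galoisA : weak_galois A) (flatA : flat_extension A) (restrictedA : restricted A)
    (M : lmodType (env A)) (q : nat)
    (I : injective_resolution (restrict_bimodule M)) :
  exists act : hochschild I q -> H -> hochschild I q, right_action act.
Proof.
have [V [d [aug [aug_inj exact0 exactS]]]] := coind_resolution M.
have [flat_l flat_r] := flatA.
have J_inj n : injective_module (restrict_bimodule (coind (env A) (V n))).
  exact: coind_injective flat_l flat_r.
(* Restriction of scalars keeps the underlying maps, so injectivity of the augmentation and
   exactness carry over unchanged. *)
pose J := @InjectiveResolution _ (restrict_bimodule M)
  (fun n => restrict_bimodule (coind (env A) (V n)))
  (fun n => restrict_map (d n)) (restrict_map aug) J_inj aug_inj exact0 exactS.
(* [phi] goes from J to I and [psi] from I to J. *)
have [phi [phi_aug phi_d]] := comparison_exists J I.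
have [psi [psi_aug psi_d]] := comparison_exists I J.
have act_bundle n h : exists g : {linear Defs.hom (env_self (coinv A)) (J n) ->
    Defs.hom (env_self (coinv A)) (J n)}, forall f, g f = hom_act galoisA f h.
  by apply: linear_bundle; case: (hom_right_action galoisA (coind (env A) (V n))).
pose act n h := projT1 (cid (act_bundle n h)).
have actE n h f : act n h f = hom_act galoisA f h by rewrite /act; case: cid.
have act_d n h f : act n.+1 h (hom_post (res_d J n) f) = hom_post (res_d J n) (act n h f).
  by rewrite !actE; apply/esym/hom_act_natural.
(* The action on J is conjugated by the two comparison maps, which are inverse only up to
   homotopy. *)
pose op h : {linear Defs.hom (env_self (coinv A)) (I q) -> Defs.hom (env_self (coinv A)) (I q)} :=
  hom_post (phi q) \o (act q h \o hom_post (psi q)).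
have act_bnd n h (f : Defs.hom (env_self (coinv A)) (J n)) :
    boundary (fun n => hom_post (res_d J n)) f ->
    boundary (fun n => hom_post (res_d J n)) (act n h f).
  case: n f => [|n] f /=; first by move=> ->; rewrite linear0.
  by move=> [b <-]; exists (act n h b); rewrite act_d.
have act_cyc n h (f : Defs.hom (env_self (coinv A)) (J n)) :
    hom_post (res_d J n) f = 0 -> hom_post (res_d J n) (act n h f) = 0.
  by move=> df; rewrite -act_d df linear0.
have [act_lin act_lin' act1 actM] := hom_right_action galoisA (coind (env A) (V q)).
apply: (@cohomology_right_action k H (fun n => Defs.hom (env_self (coinv A)) (I n))
  (fun n => hom_post (res_d I n)) q op).
- move=> x c g h; rewrite /op /= !actE act_lin'; exact: linearP.
- move=> h x dx; apply: (hom_post_cocycle phi_d); apply: act_cyc.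
  exact: (hom_post_cocycle psi_d dx).
- move=> h x dx; apply: (hom_post_boundary phi_d); apply: act_bnd.
  exact: (hom_post_boundary psi_d dx).
- move=> x dx; rewrite /op /= actE act1.
  exact: (hom_post_comparison psi_aug psi_d phi_aug phi_d dx).
- move=> g h x dx; rewrite /op /=.
  set y := hom_post (psi q) x.
  have dy : hom_post (res_d J q) y = 0 by exact: (hom_post_cocycle psi_d dx).
  (* The difference becomes phi(h · (psi phi z - z)) with z = [act q g y] a cocycle of J, and the
     inner difference is a coboundary by comparison on J. *)
  have -> : act q (g * h) y = act q h (act q g y) by rewrite !actE actM.
  rewrite -!linearB; apply: (hom_post_boundary phi_d); apply: act_bnd.
  apply: (hom_post_comparison phi_aug phi_d psi_aug psi_d); exact: act_cyc.
Qed.
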